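(* For every $n>0$, the $H$-triangle $H_n(x,y)$ associated with the Hochschild lattice $\mathrm{Hoch}(n)$ satisfies $$H_n(x,y)=\sum_{A}x^{|A|}y^{|A\cap\mathrm{Atom}(n)|},$$ where the sum runs over all antichains $A$ (including the empty one) of the poset $\mathbf{J}_n$.
   Context: Hochschild lattice. For $n\geq 1$, a triword of length $n$ is a tuple $u=(u_1,\ldots,u_n)$ such that (T1) $u_i\in\{0,1,2\}$ for all $i$; (T2) $u_1\neq 2$; (T3) if $u_i=0$, then $u_j\neq 1$ for all $j>i$. Let $\mathrm{Tri}(n)$ be the set of all triwords of length $n$. The Hochschild lattice is $\mathrm{Hoch}(n)=(\mathrm{Tri}(n),\leq)$ where $\leq$ is the componentwise order. It is known to be a semidistributive lattice: the join is the componentwise maximum, and the meet is obtained by taking the componentwise minimum and then replacing by $0$ every entry $1$ that has an entry $0$ somewhere to its left. Its join-irreducible elements are the triwords $\mathfrak{a}^{(i)}=(1,\ldots,1,0,\ldots,0)$ ($i$ ones followed by zeros) for $1\leq i\leq n$ and $\mathfrak{b}^{(i)}$ (a $2$ in position $i$, zeros elsewhere) for $2\leq i\leq n$. Its set of atoms is $\mathrm{Atom}(n)=\{\mathfrak{a}^{(1)},\mathfrak{b}^{(2)},\ldots,\mathfrak{b}^{(n)}\}$. The poset $\mathbf{J}_n$. $\mathbf{J}_n$ is the poset on the set of join-irreducible elements of $\mathrm{Hoch}(n)$ obtained from the componentwise order on this set by adding the relations $\mathfrak{b}^{(2)}<\mathfrak{a}^{(i)}$ for all $i>1$. Core label order.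 Let $L$ be a finite semidistributive lattice. For a cover relation $a\lessdot b$ put $\lambda(a,b)=\min\{c\in L\mid a\vee c=b\}$; this minimum exists and is join irreducible. The nucleus of $a\in L$ is $a_\downarrow=a\wedge\bigwedge_{b\lessdot a}b$. The core label set of $a$ is $\Psi(a)=\{\lambda(b,b')\mid a_\downarrow\leq b\lessdot b'\leq a\}$. The map $a\mapsto\Psi(a)$ is injective. The core label order $\mathrm{CLO}(L)$ is the poset $(L,\sqsubseteq)$ where $a\sqsubseteq b$ if and only if $\Psi(a)\subseteq\Psi(b)$. $H$-triangle. The poset $\mathrm{CLO}(\mathrm{Hoch}(n))$ is graded with least element $(0,\ldots,0)$; let $\mathrm{rk}$ be its rank function (so $\mathrm{rk}(0,\ldots,0)=0$) and $\mu_n$ its Möbius function (with $\mu_n(u,v)=0$ if $u\not\sqsubseteq v$). Define $$M_n(x,y)=\sum_{u,v\in\mathrm{Tri}(n)}\mu_n(u,v)\,x^{\mathrm{rk}(u)}y^{\mathrm{rk}(v)},\qquad H_n(x,y)=\bigl(x(y-1)+1\bigr)^n M_n\left(\frac{y}{y-1},\frac{x(y-1)}{x(y-1)+1}\right).$$ *)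

(* Defs.v *)
From HB Require Import structures.
From mathcomp Require Import all_boot all_order all_algebra.

Set Implicit Arguments.
Unset Strict Implicit.
Unset Printing Implicit Defensive.

Import Order.TTheory GRing.Theory.

Definition covers d (T : finPOrderType d) (a b : T) : bool :=
  (a < b)%O && ~~ [exists c, (a < c < b)%O].

Definition chain d (T : finPOrderType d) (C : {set T}) : bool :=
  [forall a in C, forall b in C, (a >=< b)%O].

Definition antichain d (T : finPOrderType d) (A : {set T}) : bool :=
  [forall a in A, forall b in A, (a <= b)%O ==> (a == b)].

(** The length of a longest chain with top element [u]; [rank_unique] below
    shows that this is the rank function of a graded poset with a least
    element. *)
Definition rank d (T : finPOrderType d) (u : T) : nat :=
  \max_(C : {set T} | chain C && [forall c in C, (c < u)%O]) #|C|.

(** The recursion depth [#|T|] exceeds the length of every chain: [mobiusE]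
    below is the defining recursion of the Moebius function. *)
Fixpoint mobius_rec d (T : finPOrderType d) (k : nat) (u v : T) : int :=
  if k is k'.+1 then
    if u == v then 1%R
    else if (u < v)%O then (- \sum_(w | (u <= w < v)%O) mobius_rec k' u w)%R
    else 0%R
  else 0%R.

Definition mobius d (T : finPOrderType d) (u v : T) : int :=
  mobius_rec #|T| u v.

Lemma lower_cover d (T : finPOrderType d) (u v : T) :
  (u < v)%O -> exists2 w, (u <= w)%O & covers w v.
Proof.
move=> uv; have [k] := ubnP #|[set c | (u < c < v)%O]|; elim: k u uv => // k IHk u uv lek.
case: (boolP [exists c, (u < c < v)%O]) => [/existsP[c /andP[uc cv]]|nex].
  have [|w cw wv] := IHk c cv; last by exists w => //; apply: le_trans cw; apply: ltW.
  rewrite ltnS in lek; apply: leq_trans lek; apply: proper_card; apply/properP; split.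
    apply/subsetP => x; rewrite !inE => /andP[cx ->]; by rewrite (lt_trans uc cx).
  by exists c; rewrite !inE ?uc ?cv // ltxx.
by exists u => //; rewrite /covers uv nex.
Qed.

Lemma rank_unique d (T : finPOrderType d) (bot : T) (rk : T -> nat) :
    (forall u, (bot <= u)%O) -> rk bot = 0 ->
    (forall u v, covers u v -> rk v = (rk u).+1) ->
  rk =1 rank (T := T).
Proof.
move=> bot_le rk0 rkS.
have mono k (u v : T) : rk v < k -> (u < v)%O -> rk u < rk v.
  elim: k u v => // k IHk u v lek /lower_cover[w uw /[dup] wv /rkS rkv].
  rewrite rkv in lek *; rewrite ltnS; move: uw; rewrite le_eqVlt => /orP[/eqP-> //|uw].
  exact/ltnW/(IHk _ _ _ uw).
have {}mono (u v : T) : (u < v)%O -> rk u < rk v by apply: mono (ltnSn _).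
move=> u; apply/eqP; rewrite eqn_leq; apply/andP; split; last first.
  apply/bigmax_leqP => C /andP[/forall_inP chC /forall_inP Cu].
  have injC : {in C &, injective (fun c => inord (rk c) : 'I_(rk u).+1)}.
    move=> x y xC yC /(congr1 val) /=.
    rewrite !inordK ?ltnS; try by apply/ltnW/mono/Cu.
    move=> eqxy; have := forall_inP (chC x xC) y yC; case: comparableP => // lt_xy _.
      by have := mono _ _ lt_xy; rewrite eqxy ltnn.
    by have := mono _ _ lt_xy; rewrite eqxy ltnn.
  rewrite -(card_in_imset injC) -ltnS -[X in _ < X]card_ord -cardsT.
  apply: proper_card; rewrite properT; apply/negP => /eqP eqT.
  have : (ord_max : 'I_(rk u).+1) \in [set: 'I_(rk u).+1] by rewrite inE.
  rewrite -eqT => /imsetP[c cC /(congr1 val)] /=; rewrite inordK ?ltnS; last exact/ltnW/mono/Cu.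
  by have := mono _ _ (Cu c cC) => /[swap] <-; rewrite ltnn.
suff [C chC <-] : exists2 C : {set T},
    chain C && [forall c in C, (c < u)%O] & #|C| = rk u by exact: leq_bigmax_cond.
have [k] := ubnP (rk u); elim: k u => // k IHk u lek.
have [-> |nbot] := eqVneq u bot.
  exists set0; last by rewrite cards0.
  by apply/andP; split; apply/forall_inP => x; rewrite inE.
have /lower_cover[w _ wu] : (bot < u)%O by rewrite lt_def nbot bot_le.
have [|C /andP[/forall_inP chC /forall_inP Cw] cardC] := IHk w.
  by rewrite (rkS _ _ wu) in lek.
have ltwu : (w < u)%O by case/andP: wu.
exists (w |: C).
  apply/andP; split.
    apply/forall_inP => x; rewrite !inE => /orP[/eqP->|xC];
      apply/forall_inP => y; rewrite !inE => /orP[/eqP->|yC].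
    - exact: comparablexx.
    - by apply/ge_comparable/ltW/Cw.
    - by apply/le_comparable/ltW/Cw.
    - exact: (forall_inP (chC x xC)).
  apply/forall_inP => x; rewrite !inE => /orP[/eqP->//|/Cw xw].
  exact: lt_trans ltwu.
rewrite cardsU1 cardC (rkS _ _ wu).
by case: (boolP (w \in C)) => // /Cw; rewrite ltxx.
Qed.

Lemma mobiusE d (T : finPOrderType d) (u v : T) :
  mobius u v =
    if u == v then 1%R
    else if (u < v)%O then (- \sum_(w | (u <= w < v)%O) mobius u w)%R
    else 0%R.
Proof.
rewrite /mobius.
have stable k k' (x : T) : #|[set c | (u <= c <= x)%O]| <= k ->
    #|[set c | (u <= c <= x)%O]| <= k' ->
    (u <= x)%O -> mobius_rec k u x = mobius_rec k' u x.
  elim: k k' x => [|k IHk] [|k'] x lek lek' ux //=.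
  - have: x \in [set c | (u <= c <= x)%O] by rewrite inE ux lexx.
    by move: lek; rewrite leqn0 cards_eq0 => /eqP->; rewrite inE.
  - have: x \in [set c | (u <= c <= x)%O] by rewrite inE ux lexx.
    by move: lek'; rewrite leqn0 cards_eq0 => /eqP->; rewrite inE.
  case: eqP => // _; case: ifP => // ltux; congr (- _)%R.
  apply: eq_bigr => w /andP[uw wx].
  have ltc : #|[set c | (u <= c <= w)%O]| < #|[set c | (u <= c <= x)%O]|.
    apply: proper_card; apply/properP; split.
      by apply/subsetP => c; rewrite !inE => /andP[-> /le_trans->] //; apply: ltW.
    exists x; first by rewrite inE ux lexx.
    by rewrite inE ux (lt_geF wx).
  by apply: IHk => //; rewrite -ltnS; apply: leq_trans ltc _.
case cardT : #|T| => [|k]; first by have := fintype0 u cardT.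
rewrite -cardT {1}cardT /=; case: eqP => // _; case: ifP => // ltuv.
congr (- _)%R; apply: eq_bigr => w /andP[uw wv]; apply: stable; rewrite ?max_card //.
rewrite -ltnS -cardT -cardsT; apply: proper_card; rewrite properT.
apply/negP => /eqP eqT; have : v \in [set: T] by rewrite inE.
by rewrite -eqT inE (lt_geF wv) andbF.
Qed.

Definition join_irreducible d (L : finTBLatticeType d) (j : L) : bool :=
  (j != \bot%O) &&
  [forall a : L, forall b : L, ((a `|` b)%O == j) ==> (a == j) || (b == j)].

Definition atom d (L : finTBLatticeType d) (a : L) : bool := covers \bot%O a.

(** [is_label a b c] says that [c] is the label lambda(a, b), the minimum of
    the set of all [c'] such that [a `|` c' = b]. *)
Definition is_label d (L : finTBLatticeType d) (a b c : L) : bool :=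
  ((a `|` c)%O == b) && [forall c' : L, ((a `|` c')%O == b) ==> (c <= c')%O].

Definition nucleus d (L : finTBLatticeType d) (a : L) : L :=
  (a `&` \meet_(b : L | covers b a) b)%O.

Definition core_label_set d (L : finTBLatticeType d) (a : L) : {set L} :=
  [set c | [exists b : L, exists b' : L,
     [&& (nucleus a <= b)%O, covers b b', (b' <= a)%O & is_label b b' c]]].

Definition join_semidistributive d (L : finTBLatticeType d) : Prop :=
  forall a b c : L, (a `|` b = a `|` c -> a `|` (b `&` c) = a `|` b)%O.

Lemma is_label_exists d (L : finTBLatticeType d) (a b : L) :
  join_semidistributive L -> covers a b -> exists c, is_label a b c.
Proof.
move=> sd /andP[ab _].
pose m := (\meet_(c : L | (a `|` c)%O == b) c)%O.
exists m; apply/andP; split; last first.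
  by apply/forall_inP => c' Hc'; apply: meets_inf.
have [s [Ps Es]] : exists s : seq L, (forall c, (c \in s) = ((a `|` c)%O == b)) /\
    (m = \meet_(c <- s) c)%O.
  exists (enum [pred c : L | (a `|` c)%O == b]); split.
    by move=> c; rewrite mem_enum.
  by rewrite big_enum.
have bs : b \in s by rewrite Ps; apply/eqP/join_r/ltW.
rewrite Es.
have {}Ps c : c \in s -> (a `|` c)%O = b by rewrite Ps => /eqP.
suff H t : {subset t <= s} -> (a `|` (b `&` \meet_(c <- t) c))%O = b.
  by have := H s (fun _ => id); rewrite meet_r ?meets_inf_seq // => ->.
elim: t => [|c t IHt] sub; first by rewrite big_nil meetx1; apply: Ps.
have {}IHt : (a `|` (b `&` \meet_(c <- t) c))%O = b.
  by apply: IHt => x xt; apply: sub; rewrite inE xt orbT.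
have cb : (a `|` c)%O = b by apply/Ps/sub; rewrite inE eqxx.
by rewrite big_cons meetCA sd // cb.
Qed.

Lemma core_label_set_join d (L : finTBLatticeType d) (a : L) :
  join_semidistributive L -> (\join_(c in core_label_set a) c)%O = a.
Proof.
move=> sd; set s := (X in X = a).
have lesa : (s <= a)%O.
  apply: joins_le => c; rewrite inE => /existsP[b /existsP[b' /and4P[_ _ b'a]]].
  case/andP => /eqP eqb' _; apply: le_trans b'a; rewrite -eqb'; exact: leUr.
apply/eqP; apply: contraT => ne.
have ltsa : (s < a)%O by rewrite lt_neqAle ne.
have [b sb ba] := lower_cover ltsa.
have [c lc] := is_label_exists sd ba.
have cs : (c <= s)%O.
  apply: joins_sup; rewrite inE; apply/existsP; exists b; apply/existsP; exists a.
  rewrite ba lc lexx !andbT /nucleus; apply: le_trans (leIr _ _) _.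
  exact: meets_inf.
case/andP: lc => /eqP; rewrite join_l ?(le_trans cs sb) // => eqba _.
by case/andP: ba; rewrite eqba ltxx.
Qed.

Lemma core_label_set_inj d (L : finTBLatticeType d) :
  join_semidistributive L -> injective (@core_label_set d L).
Proof.
by move=> sd a b eqab; rewrite -(core_label_set_join a sd) eqab core_label_set_join.
Qed.

(** Positions are numbered from 0: the entry u_i is [u] at index i - 1. *)
Definition is_triword n (u : {ffun 'I_n -> 'I_3}) : bool :=
  [forall i : 'I_n, (i == 0 :> nat) ==> (u i != 2 :> nat)] &&
  [forall i : 'I_n, forall j : 'I_n,
     (i < j) && (u i == 0 :> nat) ==> (u j != 1 :> nat)].

Record Hoch n := Triword {entry :> {ffun 'I_n -> 'I_3}; _ : is_triword entry}.

HB.instance Definition _ n := [isSub for @entry n].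
HB.instance Definition _ n := [Finite of Hoch n by <:].

Lemma triwordP n (u : {ffun 'I_n -> 'I_3}) :
  reflect ((forall i : 'I_n, i = 0 :> nat -> u i <> 2 :> nat) /\
           (forall i j : 'I_n, i < j -> u i = 0 :> nat -> u j <> 1 :> nat))
          (is_triword u).
Proof.
apply: (iffP andP) => [[/forallP h1 /forallP h2]|[h1 h2]]; split.
- by move=> i i0; apply/eqP; have := h1 i; rewrite i0 eqxx.
- move=> i j ij ui0; apply/eqP; have /forallP/(_ j) := h2 i.
  by rewrite ij ui0 eqxx.
- by apply/forallP => i; apply/implyP => /eqP /h1 /eqP.
- apply/forallP => i; apply/forallP => j; apply/implyP => /andP[ij /eqP ui0].
  exact/eqP/(h2 i j).
Qed.

Definition Hoch_le n (u v : Hoch n) : bool := [forall i, u i <= v i].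

Lemma Hoch_le_refl n : reflexive (@Hoch_le n).
Proof. by move=> u; apply/forallP => i. Qed.

Lemma Hoch_le_anti n : antisymmetric (@Hoch_le n).
Proof.
move=> u v /andP[/forallP uv /forallP vu]; apply/val_inj/ffunP => i.
by apply/val_inj/eqP; rewrite eqn_leq uv vu.
Qed.

Lemma Hoch_le_trans n : transitive (@Hoch_le n).
Proof.
move=> v u w /forallP uv /forallP vw; apply/forallP => i.
exact: leq_trans (uv i) (vw i).
Qed.

Fact Hoch_display : Order.disp_t. Proof. exact: Order.Disp tt tt. Qed.

HB.instance Definition _ n := Order.Le_isPOrder.Build Hoch_display (Hoch n)
  (@Hoch_le_refl n) (@Hoch_le_anti n) (@Hoch_le_trans n).

Lemma Hoch_leP n (u v : Hoch n) :
  reflect (forall i, u i <= v i) (u <= v)%O.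
Proof. exact: forallP. Qed.

Definition bot_entry n : {ffun 'I_n -> 'I_3} := [ffun=> inord 0].
Definition top_entry n : {ffun 'I_n -> 'I_3} :=
  [ffun i : 'I_n => if i == 0 :> nat then inord 1 else inord 2].
Definition join_entry n (u v : Hoch n) : {ffun 'I_n -> 'I_3} :=
  [ffun i => inord (maxn (u i) (v i))].
Definition meet_entry n (u v : Hoch n) : {ffun 'I_n -> 'I_3} :=
  [ffun i => inord (let m j := minn (u j) (v j) in
     if (m i == 1) && [exists j : 'I_n, (j < i) && (m j == 0)] then 0
     else m i)].

Lemma join_entryE n (u v : Hoch n) i : join_entry u v i = maxn (u i) (v i) :> nat.
Proof. by rewrite ffunE inordK // gtn_max !ltn_ord. Qed.

Lemma meet_entryE n (u v : Hoch n) i :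
  meet_entry u v i = (if (minn (u i) (v i) == 1) &&
    [exists j : 'I_n, (j < i) && (minn (u j) (v j) == 0)] then 0
    else minn (u i) (v i)) :> nat.
Proof.
rewrite ffunE inordK //=; case: ifP => // _.
by apply: leq_ltn_trans (geq_minl _ _) (ltn_ord _).
Qed.

Lemma bot_triword n : is_triword (bot_entry n).
Proof. by apply/triwordP; split=> [i _|i j _ _]; rewrite ffunE inordK. Qed.

Lemma top_triword n : is_triword (top_entry n).
Proof.
apply/triwordP; split=> [i i0|i j ij]; rewrite ffunE.
  by rewrite i0 /= inordK.
by case: ifP => _; rewrite inordK.
Qed.

Lemma join_triword n (u v : Hoch n) : is_triword (join_entry u v).
Proof.
have /triwordP[u1 u2] := valP u; have /triwordP[v1 v2] := valP v.
apply/triwordP; split=> [i i0|i j ij]; rewrite !join_entryE.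
  by have := u1 i i0; have := v1 i i0; rewrite /maxn; case: ifP.
move/eqP; rewrite -leqn0 geq_max !leqn0 => /andP[/eqP ui /eqP vi].
by have := u2 i j ij ui; have := v2 i j ij vi; rewrite /maxn; case: ifP.
Qed.

Lemma meet_triword n (u v : Hoch n) : is_triword (meet_entry u v).
Proof.
have /triwordP[u1 u2] := valP u; have /triwordP[v1 v2] := valP v.
apply/triwordP; split=> [i i0|i j ij]; rewrite !meet_entryE.
  case: ifP => // _; have := u1 i i0; have := v1 i i0.
  by rewrite /minn; case: ifP.
move=> mi0; case: ifP => // /negbT; rewrite negb_and => /orP[/eqP//|nex] _.
case/negP: nex; move: mi0; case: ifP => [/andP[_ /existsP[k /andP[ki mk]]] _|_ mi].
  by apply/existsP; exists k; rewrite mk (ltn_trans ki ij).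
by apply/existsP; exists i; rewrite ij mi.
Qed.

Definition Hoch_join n (u v : Hoch n) : Hoch n := Triword (join_triword u v).
Definition Hoch_meet n (u v : Hoch n) : Hoch n := Triword (meet_triword u v).

Lemma Hoch_meetP n (w u v : Hoch n) :
  (w <= Hoch_meet u v)%O = (w <= u)%O && (w <= v)%O.
Proof.
apply/Hoch_leP/andP => [h|[/Hoch_leP wu /Hoch_leP wv] i].
  have {}h i : w i <= minn (u i) (v i).
    by apply: leq_trans (h i) _; rewrite /= meet_entryE; case: ifP.
  by split; apply/Hoch_leP => i; apply: leq_trans (h i) _; rewrite ?geq_minl ?geq_minr.
rewrite /= meet_entryE.
have wm j : w j <= minn (u j) (v j) by rewrite leq_min wu wv.
case: ifP => // /andP[/eqP mi /existsP[j /andP[ji /eqP mj]]].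
have /triwordP[_ w2] := valP w.
have wj : w j = 0 :> nat by apply/eqP; move: (wm j); rewrite mj leqn0.
have := w2 j i ji wj; have := wm i; rewrite mi.
by case: (nat_of_ord (w i)) => [|[|]].
Qed.

Lemma Hoch_joinP n (u v w : Hoch n) :
  (Hoch_join u v <= w)%O = (u <= w)%O && (v <= w)%O.
Proof.
apply/Hoch_leP/andP => [h|[/Hoch_leP uw /Hoch_leP vw] i].
  have {}h i : maxn (u i) (v i) <= w i.
    by have := h i; rewrite /= join_entryE.
  by split; apply/Hoch_leP => i; apply: leq_trans (h i); rewrite ?leq_maxl ?leq_maxr.
by rewrite /= join_entryE geq_max uw vw.
Qed.

HB.instance Definition _ n :=
  Order.POrder_MeetJoin_isLattice.Build Hoch_display (Hoch n)
    (@Hoch_meetP n) (@Hoch_joinP n).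

Lemma Hoch_bot_le n (u : Hoch n) : (Triword (bot_triword n) <= u)%O.
Proof. by apply/Hoch_leP => i; rewrite ffunE inordK. Qed.

Lemma Hoch_le_top n (u : Hoch n) : (u <= Triword (top_triword n))%O.
Proof.
apply/Hoch_leP => i; rewrite ffunE; case: ifP => [/eqP i0|_]; rewrite inordK //.
  have /triwordP[/(_ i i0) ui _] := valP u.
  by move: ui (ltn_ord (u i)); case: (nat_of_ord (u i)) => [|[|[|]]].
by rewrite -ltnS ltn_ord.
Qed.

HB.instance Definition _ n :=
  Order.hasBottom.Build Hoch_display (Hoch n) (@Hoch_bot_le n).
HB.instance Definition _ n :=
  Order.hasTop.Build Hoch_display (Hoch n) (@Hoch_le_top n).

Lemma Hoch_join_semidistributive n : join_semidistributive (Hoch n).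
Proof.
move=> a c d eqcd; apply/le_anti; rewrite leU2 ?leIl //=.
rewrite leUx leUl /=; apply/Hoch_leP => i.
have E (x y : Hoch n) j : (x `|` y)%O j = maxn (x j) (y j) :> nat by apply: join_entryE.
have eqi j : maxn (a j) (c j) = maxn (a j) (d j) by rewrite -!E eqcd.
rewrite E; have := eqi i; case: (leqP (c i) (a i)) => [ca _|ac].
  by rewrite (leq_trans ca) ?leq_maxl.
case: (leqP (d i) (a i)) => [da eqac|ad eqac]; first by rewrite -eqac ltnn in ac.
have -> : (c `&` d)%O i = minn (c i) (d i) :> nat.
  rewrite [LHS]meet_entryE; case: ifP => // /andP[mi1 /existsP[j /andP[ji /eqP mj0]]].
  have eqi' : d i = c i :> nat by [].
  rewrite eqi' minnn in mi1.
  have /triwordP[_ c2] := valP c; have /triwordP[_ d2] := valP d.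
  have [cj|dj] : c j = 0 :> nat \/ d j = 0 :> nat.
    by move: mj0; rewrite /minn; case: ifP; [left|right].
    by case: (c2 j i ji cj); apply/eqP.
  by case: (d2 j i ji dj); rewrite eqi'; apply/eqP.
by rewrite -eqac minnn leq_maxr.
Qed.

Definition CLO n : Type := Hoch n.

HB.instance Definition _ n := Finite.on (CLO n).

Definition CLO_le n (u v : CLO n) : bool :=
  core_label_set (u : Hoch n) \subset core_label_set (v : Hoch n).

Lemma CLO_le_refl n : reflexive (@CLO_le n).
Proof. by move=> u; apply: subxx. Qed.

Lemma CLO_le_anti n : antisymmetric (@CLO_le n).
Proof.
move=> u v uv; apply: (core_label_set_inj (@Hoch_join_semidistributive n)).
by apply/eqP; rewrite eqEsubset.
Qed.

Lemma CLO_le_trans n : transitive (@CLO_le n).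
Proof. by move=> v u w; apply: subset_trans. Qed.

Fact CLO_display : Order.disp_t. Proof. exact: Order.Disp tt tt. Qed.

HB.instance Definition _ n := Order.Le_isPOrder.Build CLO_display (CLO n)
  (@CLO_le_refl n) (@CLO_le_anti n) (@CLO_le_trans n).

Lemma CLO_leE n (u v : CLO n) : (u <= v)%O =
  (core_label_set (u : Hoch n) \subset core_label_set (v : Hoch n)).
Proof. by []. Qed.

(** With positions numbered from 0, [is_a k u] says that u = a^(k), and
    [is_b k u] that u = b^(k). *)
Definition is_a n (k : nat) (u : Hoch n) : bool :=
  [forall i : 'I_n, u i == (if i < k then 1 else 0) :> nat].
Definition is_b n (k : nat) (u : Hoch n) : bool :=
  [forall i : 'I_n, u i == (if i.+1 == k then 2 else 0) :> nat].

Lemma join_irreducible_ab n (u : Hoch n) : join_irreducible u ->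
  (exists2 k : 'I_n.+1, 0 < k & is_a k u) \/
  (exists2 k : 'I_n.+1, 1 < k & is_b k u).
Proof.
case/andP=> nbot /forallP irr; have /triwordP[u1 u2] := valP u.
case: (boolP [exists i, u i == 2 :> nat]) => [/existsP[i /eqP ui]|no2].
  right; have i0 : i <> 0 :> nat by move/u1; rewrite ui.
  pose x : {ffun 'I_n -> 'I_3} := [ffun j => if j == i then inord 2 else inord 0].
  pose e := [exists l : 'I_n, (i < l) && (u l == 1 :> nat)].
  pose y : {ffun 'I_n -> 'I_3} := [ffun j => if j == i then inord e else u j].
  have xE j : x j = (if j == i then 2 else 0) :> nat by rewrite ffunE; case: ifP => _; rewrite inordK.
  have yE j : y j = (if j == i then (e : nat) else u j) :> nat.
    by rewrite ffunE; case: ifP => // _; rewrite inordK //; case: (e).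
  have xT : is_triword x.
    apply/triwordP; split=> [j j0|j l _ _]; rewrite xE; last by case: ifP.
    by case: eqP => // ji; case: i0; rewrite -ji.
  have yT : is_triword y.
    apply/triwordP; split=> [j j0|j l jl]; rewrite !yE.
      by case: ifP => [_|_]; [case: (e)|apply: u1].
    case: (eqVneq j i) => [ji|ji].
      have -> : (l == i) = false by apply/negP => /eqP li; rewrite ji li ltnn in jl.
      case E: e => // _ ul; case/negP: (negbT E); rewrite /e; apply/existsP; exists l.
      by rewrite -ji jl ul.
    move=> uj; case: (eqVneq l i) => [li|_]; last exact: u2 jl uj.
    case E: e => // _; move: E; rewrite /e => /existsP[] m /andP[im /eqP um].
    by apply: (u2 j m) um => //; rewrite -li in im; apply: ltn_trans im.
  have xy : (Triword xT `|` Triword yT)%O = u.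
    apply/val_inj/ffunP => j; apply/val_inj.
    rewrite /= [LHS]join_entryE /= xE yE; case: eqP => [->|_]; last by rewrite max0n.
    by rewrite ui; case: (e).
  have := implyP (forallP (irr (Triword xT)) (Triword yT)); rewrite xy => /(_ (eqxx _)).
  case/orP => /eqP E.
    have ik : i.+1 < n.+1 by rewrite ltnS ltn_ord.
    exists (Ordinal ik); first by rewrite /= ltnS lt0n; apply/eqP.
    by apply/forallP => j; rewrite -E /= xE eqSS -(inj_eq val_inj).
  by have := yE i; rewrite -[y]/(entry (Triword yT)) E ui eqxx; case: (e).
left.
have small j : u j <> 0 :> nat -> u j = 1 :> nat.
  move=> uj; have := negbT (negbTE no2); rewrite negb_exists => /forallP/(_ j).
  by move: uj (ltn_ord (u j)); case: (nat_of_ord (u j)) => [|[|[|]]].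
case: (boolP [exists i, u i == 0 :> nat]) => [/existsP[i0 ui0]|no0].
  case: (arg_minnP (P := fun i => u i == 0 :> nat) (fun i : 'I_n => nat_of_ord i) ui0).
  move=> i /eqP ui imin.
  have ik : i < n.+1 by rewrite ltnS ltnW.
  have E : is_a (Ordinal ik) u.
    apply/forallP => j /=; case: ltnP => [ji|ij].
      by apply/eqP/small => /eqP /imin; rewrite leqNgt ji.
    move: ij; rewrite leq_eqVlt => /orP[/eqP/val_inj<-|ij]; first by rewrite ui.
    apply/eqP; case E: (nat_of_ord (u j)) => [//|m]; have := small j; rewrite E => /(_ (fun H => ltac:(discriminate H))) m0.
    by case: (u2 i j ij ui); rewrite E m0.
  exists (Ordinal ik) => //=; rewrite lt0n; apply/negP => /eqP iz.
  case/eqP: nbot; apply/val_inj/ffunP => j; apply/val_inj.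
  by have /forallP/(_ j)/eqP := E; rewrite /= iz ltn0 => ->; rewrite ffunE inordK.
exists ord_max.
  rewrite /= lt0n; apply/negP => /eqP nz; case/eqP: nbot.
  apply/val_inj/ffunP => j; have := ltn_ord j; by rewrite {2}nz.
apply/forallP => j; rewrite /= ltn_ord; apply/eqP/small => uj.
by case/existsP: no0; exists j; rewrite uj.
Qed.

Record Jposet n := JIrr {jval :> Hoch n; _ : join_irreducible jval}.

HB.instance Definition _ n := [isSub for @jval n].
HB.instance Definition _ n := [Finite of Jposet n by <:].

(** The componentwise order together with the relations b^(2) < a^(i), i > 1;
    this union is already transitive. *)
Definition Jposet_le n (u v : Jposet n) : bool :=
  (jval u <= jval v)%O || is_b 2 u && [exists i : 'I_n.+1, (1 < i) && is_a i v].

Lemma Jposet_le_refl n : reflexive (@Jposet_le n).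
Proof. by move=> u; rewrite /Jposet_le lexx. Qed.

Lemma Jposet_le_cases n (u v : Jposet n) :
  Jposet_le u v -> (jval u <= jval v)%O \/
  is_b 2 u /\ exists i : 'I_n.+1, 1 < i /\ is_a i v.
Proof.
case/orP => [|/andP[bu /existsP[i /andP[i1 av]]]]; first by left.
by right; split=> //; exists i.
Qed.

Lemma is_b_inj n k (u v : Jposet n) : is_b k u -> is_b k v -> u = v.
Proof.
move=> /forallP bu /forallP bv; apply/val_inj/val_inj/ffunP => i; apply/val_inj.
by rewrite /= (eqP (bu i)) (eqP (bv i)).
Qed.

Lemma Jposet_below_b n (u v : Jposet n) k :
  is_b k v -> (jval u <= jval v)%O -> u = v.
Proof.
move=> bv /Hoch_leP uv; have [v1 _] := triwordP _ (valP (jval v)).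
have vE i := eqP (forallP bv i).
have [[m m0 /forallP au]|[m m1 bu]] := join_irreducible_ab (valP u).
  have n0 : 0 < n by apply: leq_trans m0 _; rewrite -ltnS ltn_ord.
  have := uv (Ordinal n0); rewrite (eqP (au _)) /= m0.
  by have := v1 (Ordinal n0) erefl; rewrite /= vE; case: ifP.
have mn : m.-1 < n by rewrite prednK ?(ltnW m1) // -ltnS ltn_ord.
have := uv (Ordinal mn); rewrite (eqP (forallP bu _)) vE /= prednK ?(ltnW m1) // eqxx.
by case: eqP => // mk _; apply: is_b_inj bv; rewrite -mk.
Qed.

Lemma Jposet_above_a n (v w : Jposet n) (k : 'I_n.+1) :
  1 < k -> is_a k v -> (jval v <= jval w)%O ->
  exists i : 'I_n.+1, 1 < i /\ is_a i w.
Proof.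
move=> k1 /forallP av /Hoch_leP vw.
have n1 : 1 < n by apply: leq_trans k1 _; rewrite -ltnS ltn_ord.
have w0 m (mn : m < n) : m < k -> 0 < w (Ordinal mn).
  by move=> mk; apply: leq_trans (vw _); have := av (Ordinal mn); rewrite /= mk => /eqP->.
have w00 := w0 0 (ltnW n1) (ltnW k1); have w01 := w0 1 n1 k1.
have [[i _ aw]|[i _ /forallP bw]] := join_irreducible_ab (valP w).
  exists i; split=> //; rewrite ltnNge; apply/negP => i1.
  have /forallP/(_ (Ordinal n1))/eqP := aw.
  by rewrite ltnNge /= i1 /= => E; rewrite E in w01.
have E0 := eqP (bw (Ordinal (ltnW n1))); have E1 := eqP (bw (Ordinal n1)).
rewrite E0 /= in w00; rewrite E1 /= in w01.
by move: w00 w01; case: (1 =P _ :> nat) => // <-.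
Qed.

Lemma Jposet_le_anti n : antisymmetric (@Jposet_le n).
Proof.
move=> u v /andP[/Jposet_le_cases[uv|[bu _]] /Jposet_le_cases[vu|[bv _]]].
- by apply/val_inj/le_anti; rewrite uv vu.
- exact: Jposet_below_b bv uv.
- exact/esym/(Jposet_below_b bu vu).
- exact: is_b_inj bu bv.
Qed.

Lemma Jposet_le_trans n : transitive (@Jposet_le n).
Proof.
move=> v u w uv vw; case: (Jposet_le_cases uv) => [uv'|[bu [i [i1 ai]]]].
  case: (Jposet_le_cases vw) => [vw'|[bv _]].
    by rewrite /Jposet_le (le_trans uv' vw').
  by rewrite (Jposet_below_b bv uv').
case: (Jposet_le_cases vw) => [vw'|[_ [j [j1 aj]]]]; rewrite /Jposet_le bu.
  have [j [j1 aj]] := Jposet_above_a i1 ai vw'.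
  by apply/orP; right; apply/existsP; exists j; rewrite j1.
by apply/orP; right; apply/existsP; exists j; rewrite j1.
Qed.

Fact J_display : Order.disp_t. Proof. exact: Order.Disp tt tt. Qed.

HB.instance Definition _ n := Order.Le_isPOrder.Build J_display (Jposet n)
  (@Jposet_le_refl n) (@Jposet_le_anti n) (@Jposet_le_trans n).

Lemma Jposet_leE n (u v : Jposet n) : (u <= v)%O =
  (jval u <= jval v)%O || is_b 2 u && [exists i : 'I_n.+1, (1 < i) && is_a i v].
Proof. by []. Qed.

Definition Atom n : {set Jposet n} := [set u | atom (jval u)].

Local Open Scope ring_scope.

Definition M_triangle n (F : fieldType) (x y : F) : F :=
  \sum_(u : CLO n) \sum_(v : CLO n)
    (mobius u v)%:~R * x ^+ rank u * y ^+ rank v.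

Definition H_triangle n (F : fieldType) (x y : F) : F :=
  (x * (y - 1) + 1) ^+ n *
  M_triangle n (y / (y - 1)) (x * (y - 1) / (x * (y - 1) + 1)).

(** The field Q(x, y) of rational functions and its two indeterminates. *)
Definition ratfun2 : fieldType := {fraction {poly {poly rat}}}.
Definition ratX : ratfun2 := tofrac ('X%:P : {poly {poly rat}}).
Definition ratY : ratfun2 := tofrac ('X : {poly {poly rat}}).

(* Main.v *)
(** A triword [u] is encoded by the set [C] of positions of its entries 2 and by
    the position [o] of its last entry 1, if any.  Its core label set consists
    of the b-elements indexed by [C] and of the a-elements indexed by the block
    of positions [m >= k] such that all of [k+1, ..., m] lie in [C], where
    [o = Some k].  Hence, writing [last_notin B k] for the largest position
    [<= k] outside [B], one has (C, o) <= (B, o') in the core label order iff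
    C is contained in B and either [o] is [None] or
    [o' = Some (last_notin B k)].

    The upper sets of the (C, Some k) are therefore Boolean lattices, and
    inverting the zeta function gives mu((C, None), (B, Some k)) =
    - (-1)^|B \ C| #{m not in C | last_notin B m = k}.  Summing over [k] turns
    the counts into |complement of C|, and M is a sum of products:
    M = P^n + (n - 1) (1 - y) (x - 1) y P^(n-2) with P = 1 + (x - 1) y.  After
    the substitution this reads (1 + xy)^n + (n - 1) x (1 + xy)^(n-2), which
    counts antichains: those made of b-elements only or containing a^(1), and
    those containing one of the other n - 1 a-elements, which exclude b^(2). *)
Require Import Defs.
From mathcomp Require Import all_boot all_order all_algebra.
From mathcomp Require Import zify ring.

Set Implicit Arguments.
Unset Strict Implicit.
Unset Printing Implicit Defensive.

Import Order.TTheory GRing.Theory.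

(** * Lower covers, nuclei and labels in a finite lattice *)

Lemma lower_cover_avoiding d (L : finTBLatticeType d) (u v c : L) :
  (v < u)%O -> (v `|` c = u)%O -> exists2 w, covers w u & ~~ (c <= w)%O.
Proof.
move=> /lower_cover[w vw wu] vcu; exists w => //; apply/negP => cw.
have : (u <= w)%O by rewrite -vcu leUx vw cw.
by case/andP: wu => /lt_geF->.
Qed.

Lemma nucleus_le d (L : finTBLatticeType d) (u w : L) :
  covers w u -> (nucleus u <= w)%O.
Proof. by move=> wu; apply: le_trans (leIr _ _) _; apply: meets_inf. Qed.

(** If [c] is the join of [p] and [q], joining [a] with either one gives [a] or [b], as nothing lies
    strictly between. Not both joins are [a], and one equal to [b] puts [c] below [p] or [q] by
    minimality. *)
Lemma label_join_irreducible d (L : finTBLatticeType d) (a b c : L) :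
  covers a b -> is_label a b c -> join_irreducible c.
Proof.
case/andP=> ab nab /andP[/eqP acb /forallP cmin]; apply/andP; split.
  by apply/eqP => c0; rewrite -acb c0 joinx0 ltxx in ab.
apply/forallP => p; apply/forallP => q; apply/implyP => /eqP pqc.
have dich r : (r <= c)%O -> (a `|` r == b)%O || (a `|` r == a)%O.
  move=> rc; have rb : (a `|` r <= b)%O by rewrite -acb leU2.
  case: (eqVneq (a `|` r)%O b) => //= nb; apply: contraR nab => na.
  by apply/existsP; exists (a `|` r)%O; rewrite !lt_neqAle eq_sym na leUl nb rb.
have pc : (p <= c)%O by rewrite -pqc leUl.
have qc : (q <= c)%O by rewrite -pqc leUr.
case/orP: (dich p pc) => [/(implyP (cmin p)) cp|/eqP ap].
  by apply/orP; left; rewrite eq_le pc cp.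
case/orP: (dich q qc) => [/(implyP (cmin q)) cq|/eqP aq].
  by apply/orP; right; rewrite eq_le qc cq.
by move: ab; rewrite -acb -pqc joinA ap aq ltxx.
Qed.

(** * Triwords as codes, and their core label sets *)

Section Words.
Variable N : nat.
Notation I := 'I_N.+1.

(** The guard [i != ord0] makes this a triword for arbitrary [C] and [o]. *)
Definition word_entry (C : {set I}) (o : option I) : {ffun I -> 'I_3} :=
  [ffun i => inord (if (i \in C) && (i != ord0) then 2
                    else oapp (fun k : I => nat_of_bool (i <= k)) 0 o)].

Lemma word_entryE (C : {set I}) o i : word_entry C o i =
  (if (i \in C) && (i != ord0) then 2
   else oapp (fun k : I => nat_of_bool (i <= k)) 0 o) :> nat.
Proof. by rewrite ffunE inordK //; case: ifP => // _; case: o => //= k; case: (i <= k). Qed.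

Lemma word_triword C o : is_triword (word_entry C o).
Proof.
apply/triwordP; split=> [i i0|i j ij]; rewrite !word_entryE.
  have -> : i = ord0 by apply/val_inj.
  by rewrite eqxx andbF; case: o => //= k.
case: ifP => // _; case: ifP => // _; case: o => //= k.
by case: leqP => // ki _; rewrite leqNgt (ltn_trans ki ij).
Qed.

Definition word C o : Hoch N.+1 := Triword (word_triword C o).

Lemma wordE (C : {set I}) o i : ord0 \notin C -> word C o i =
  (if i \in C then 2 else oapp (fun k : I => nat_of_bool (i <= k)) 0 o) :> nat.
Proof.
move=> C0; rewrite [LHS]word_entryE; case: eqP => [->|_]; last by rewrite andbT.
by rewrite andbF (negbTE C0).
Qed.

Lemma Hoch_eqP (u v : Hoch N.+1) : (forall i, u i = v i :> nat) -> u = v.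
Proof. by move=> uv; apply/val_inj/ffunP => i; apply/val_inj/uv. Qed.

Lemma joinE (u v : Hoch N.+1) i : (u `|` v)%O i = maxn (u i) (v i) :> nat.
Proof. exact: join_entryE. Qed.

Lemma entry_le2 (u : Hoch N.+1) i : u i <= 2.
Proof. by rewrite -ltnS. Qed.

Lemma entry_0 (u : Hoch N.+1) : u ord0 != 2 :> nat.
Proof. by have /triwordP[/(_ ord0 erefl)/eqP] := valP u. Qed.

Lemma entry_before_one (u : Hoch N.+1) (i j : I) :
  i <= j -> u j = 1 :> nat -> u i != 0 :> nat.
Proof.
rewrite leq_eqVlt => /orP[/eqP/val_inj-> ->//|ij uj].
by have /triwordP[_ u2] := valP u; apply/eqP => /(u2 _ _ ij).
Qed.

Definition code (u : Hoch N.+1) : {set I} * option I :=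
  ([set i | u i == 2 :> nat],
   [pick k | (u k == 1 :> nat) && [forall j : I, (k < j) ==> (u j != 1 :> nat)]]).

(** By [code_codes] and [wordK], this is exactly the image of [code]. *)
Definition codes : pred ({set I} * option I) :=
  [pred p : {set I} * option I |
     (ord0 \notin p.1) && oapp (fun k => k \notin p.1) true p.2].

Lemma codeK u : word (code u).1 (code u).2 = u.
Proof.
have C0 : ord0 \notin (code u).1 by rewrite inE entry_0.
apply: Hoch_eqP => i; rewrite wordE // inE; case: eqP => [->//|ui2] /=.
have ui := entry_le2 u i.
case: pickP => [k /andP[/eqP uk /forallP kmax]|nok] /=.
  case: leqP => [ik|ki].
    by have := entry_before_one ik uk; move: ui2 ui; lia.
  by have := implyP (kmax i) ki; move: ui2 ui; lia.
case: (eqVneq (u i : nat) 1) => [ui1|]; last by move: ui2 ui; lia.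
have [k /eqP uk kmax] :=
  arg_maxnP (P := fun i => u i == 1 :> nat) (fun i : I => nat_of_ord i) (introT eqP ui1).
have := nok k; rewrite uk eqxx /= => /negP; case; apply/forallP => j.
by apply/implyP; rewrite ltnNge; apply: contra => /kmax.
Qed.

Lemma code_inj : injective code.
Proof. by move=> u v E; rewrite -(codeK u) E codeK. Qed.

Lemma code_codes u : code u \in codes.
Proof.
rewrite !inE entry_0 /=; case: pickP => //= k /andP[/eqP uk _].
by rewrite inE uk.
Qed.

Lemma wordK p : p \in codes -> code (word p.1 p.2) = p.
Proof.
case: p => C o /andP[/= C0 oC]; congr pair.
  apply/setP => i; rewrite inE wordE //; case: ifP => //.
  by case: o {oC} => //= k; case: (_ <= _)%N.
case: o oC => [k|] /= kC; case: pickP => [j|] //=; last 1 first.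
- by rewrite wordE //=; case: ifP.
- rewrite wordE //=; case: ifP => // jC; case: leqP => //= jk /forallP/(_ k).
  rewrite wordE // (negbTE kC) /= leqnn implybF -leqNgt => kj.
  by congr Some; apply/val_inj/eqP; rewrite eqn_leq jk kj.
- move=> /(_ k); rewrite wordE // (negbTE kC) /= leqnn /= => /negbT/negP; case; apply/forallP => j.
  by rewrite wordE //; apply/implyP => kj; case: ifP => // _; rewrite /= leqNgt kj.
Qed.

Lemma Hoch_ind (P : Hoch N.+1 -> Prop) :
  (forall (C : {set I}) o, ord0 \notin C ->
     oapp (fun k => k \notin C) true o -> P (word C o)) ->
  forall u, P u.
Proof.
by move=> Pword u; rewrite -(codeK u); have /andP[C0 oC] := code_codes u; apply: Pword.
Qed.

(** Positions are numbered from 0: [ael m] is a^(m+1) and [bel i] is b^(i+1),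
    the latter only for [i != ord0] ([bel ord0] is the bottom). *)
Definition ael (m : I) := word set0 (Some m).
Definition bel (i : I) := word [set i] None.

Lemma aelE (m i : I) : ael m i = (i <= m) :> nat.
Proof. by rewrite wordE ?inE. Qed.

Lemma belE (i j : I) : i != ord0 -> bel i j = (if j == i then 2 else 0) :> nat.
Proof. by move=> i0; rewrite wordE !inE // eq_sym. Qed.

Lemma ael_leP (m : I) (u : Hoch N.+1) :
  reflect (forall j : I, j <= m -> u j != 0 :> nat) (ael m <= u)%O.
Proof.
apply: (iffP (Hoch_leP _ _)) => [h j jm|h j].
  by have := h j; rewrite aelE jm; case: (nat_of_ord (u j)).
by rewrite aelE; case: (leqP j m) => // jm; have := h j jm; case: (nat_of_ord (u j)).
Qed.

Lemma bel_le (i : I) (u : Hoch N.+1) : i != ord0 -> (bel i <= u)%O = (u i == 2 :> nat).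
Proof.
move=> i0; apply/Hoch_leP/eqP => [/(_ i)|ui j].
  by rewrite belE // eqxx; have := entry_le2 u i; lia.
by rewrite belE //; case: eqP => // ->; rewrite ui.
Qed.

(** Lowering the 2 at [i] gives a smaller triword whose join with [bel i] is [u]. Hence some lower
    cover of [u] is not above [bel i], and the nucleus lies below that cover. *)
Lemma nucleus_two (u : Hoch N.+1) (i : I) : u i = 2 :> nat -> nucleus u i <= 1.
Proof.
elim/Hoch_ind: u => C o C0 oC; rewrite wordE //.
case: ifP => [iC _|]; last by case: (o) => //= k; case: (_ <= _)%N.
have i0 : i != ord0 by apply: contra C0 => /eqP<-.
have C0' : ord0 \notin C :\ i by rewrite !inE (negbTE C0) andbF.
have joinC : (word (C :\ i) o `|` bel i)%O = word C o.
  apply: Hoch_eqP => j; rewrite joinE belE // !wordE // !inE.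
  case: eqP => [->|_] /=; last by rewrite maxn0.
  by rewrite iC; case: (o) => //= k; case: (_ <= _)%N.
have ltC : (word (C :\ i) o < word C o)%O.
  rewrite lt_neqAle -joinC leUl andbT joinC; apply/eqP.
  move/(congr1 (fun u : Hoch N.+1 => nat_of_ord (u i))).
  by rewrite !wordE // iC !inE eqxx /=; case: (o) => //= k; case: (_ <= _)%N.
have [w wu] := lower_cover_avoiding ltC joinC.
rewrite bel_le // => wi; have /Hoch_leP/(_ i) := nucleus_le wu.
by have := entry_le2 w i; lia.
Qed.

(** Some lower cover is not above [ael k], since [word C None] joins with [ael k] to the whole word.
    A 1 at [k] in that cover would make all earlier entries nonzero and put it above [ael k]. *)
Lemma nucleus_last (C : {set I}) k : ord0 \notin C -> k \notin C ->
  nucleus (word C (Some k)) k = 0 :> nat.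
Proof.
move=> C0 kC.
have joinC : (word C None `|` ael k)%O = word C (Some k).
  by apply: Hoch_eqP => j; rewrite joinE aelE !wordE //; case: ifP => _ /=; case: leqP.
have ltC : (word C None < word C (Some k))%O.
  rewrite lt_neqAle -joinC leUl andbT joinC; apply/eqP.
  move/(congr1 (fun u : Hoch N.+1 => nat_of_ord (u k))).
  by rewrite !wordE // (negbTE kC) /= leqnn.
have [w wu] := lower_cover_avoiding ltC joinC.
have wk : w k <= 1.
  have /andP[/ltW/Hoch_leP/(_ k)] := wu.
  by rewrite wordE // (negbTE kC) /= leqnn.
move=> /ael_leP kw; have /Hoch_leP/(_ k) := nucleus_le wu.
case: (nat_of_ord (w k) =P 1) => [w1|]; last by move: wk; lia.
by case: kw => j jk; apply: entry_before_one jk w1.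
Qed.

Definition blabels (u : Hoch N.+1) : {set I} := [set i | u i == 2 :> nat].
(** The coerced boolean [m < j] is the forbidden value at [j]: 0 up to position [m], 1 beyond it. *)
Definition alabels (u : Hoch N.+1) : {set I} :=
  [set m : I | [forall j : I, u j != (m < j) :> nat]].

Lemma alabelsP (u : Hoch N.+1) (m : I) :
  reflect ((forall j : I, j <= m -> u j != 0 :> nat) /\
           (forall j : I, m < j -> u j != 1 :> nat)) (m \in alabels u).
Proof.
rewrite inE; apply: (iffP forallP) => [h|[h1 h2] j].
  by split=> j; have := h j; case: leqP.
by case: leqP => [/h1|/h2].
Qed.

Lemma join_irreducible_ael_bel c : join_irreducible c ->
  (exists m, c = ael m) \/ (exists2 i, i != ord0 & c = bel i).
Proof.
case/join_irreducible_ab => [[k k0 /forallP ck]|[k k1 /forallP ck]].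
  have kN : k.-1 < N.+1 by rewrite prednK // -ltnS.
  left; exists (Ordinal kN); apply: Hoch_eqP => i; rewrite aelE (eqP (ck i)) /=.
  have -> : (i <= k.-1) = (i < k) by rewrite -ltnS prednK.
  by case: leqP.
have kN : k.-1 < N.+1 by rewrite prednK ?(ltnW k1) // -ltnS.
have i0 : Ordinal kN != ord0 by rewrite -val_eqE /=; move: k1; lia.
right; exists (Ordinal kN) => //; apply: Hoch_eqP => i; rewrite belE // (eqP (ck i)).
by have -> : (i == Ordinal kN) = (i.+1 == k) by rewrite -val_eqE /=; move: k1; lia.
Qed.

Lemma core_label_ael_bel u c : c \in core_label_set u ->
  (exists m, c = ael m) \/ (exists2 i, i != ord0 & c = bel i).
Proof.
rewrite inE => /existsP[b /existsP[b' /and4P[_ bb' _ /(label_join_irreducible bb')]]].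
exact: join_irreducible_ael_bel.
Qed.

(** For an entry 2 at [i], the cover is found just below the join of the nucleus with [bel i]: a
    lower cover [b] above the nucleus has no 2 at [i], so whatever completes it to the join must
    have one. *)
Lemma bel_core_label u i : i != ord0 -> (bel i \in core_label_set u) = (i \in blabels u).
Proof.
move=> i0; rewrite !inE.
apply/existsP/idP => [[b /existsP[b' /and4P[_ _ b'u /andP[/eqP bi _]]]]|/eqP ui].
  by rewrite -bel_le //; apply: le_trans b'u; rewrite -bi leUr.
set x := nucleus u.
have xi : ~~ (bel i <= x)%O by rewrite bel_le //; have := nucleus_two ui; rewrite -/x; lia.
have ltx : (x < x `|` bel i)%O.
  by rewrite lt_neqAle leUl andbT; apply: contra xi => /eqP->; rewrite leUr.
have [b xb bb'] := lower_cover ltx; have /andP[ltb nb] := bb'.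
have bi : ~~ (bel i <= b)%O.
  by apply/negP => bi; have := lt_geF ltb; rewrite leUx xb bi.
exists b; apply/existsP; exists (x `|` bel i)%O; rewrite xb bb' /=.
rewrite leUx bel_le // ui eqxx andbT leIl /=; apply/andP; split.
  have le1 : (b `|` bel i <= x `|` bel i)%O by rewrite leUx ltW // leUr.
  apply: contraR nb => ne; apply/existsP; exists (b `|` bel i)%O.
  rewrite [(_ < x `|` _)%O]lt_neqAle ne le1 lt_neqAle leUl !andbT.
  by apply: contra bi => /eqP->; rewrite leUr.
apply/forall_inP => c /eqP bc; rewrite bel_le //.
have: (bel i <= b `|` c)%O by rewrite bc leUr.
move: bi; rewrite !bel_le // joinE; have := entry_le2 b i; have := entry_le2 c i; lia.
Qed.

Lemma ael_join_irreducible m (b c : Hoch N.+1) :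
  (b `|` c = ael m)%O -> b = ael m \/ c = ael m.
Proof.
move=> bc; have key d : (d <= ael m)%O -> d m = 1 :> nat -> d = ael m.
  move=> dm d1; apply/le_anti; rewrite dm /=; apply/ael_leP => j jm.
  exact: entry_before_one jm d1.
have bm : maxn (b m) (c m) = 1 by rewrite -joinE bc aelE leqnn.
have [b1|c1] : b m = 1 :> nat \/ c m = 1 :> nat by move: bm; lia.
  by left; apply: key b1; rewrite -bc leUl.
by right; apply: key c1; rewrite -bc leUr.
Qed.

(** Suppose [u] is above [ael m] and has a 1 at some [j > m]. A lower cover not above [ael m] would
    join with it to [u], hence keep the 1 at [j], hence be nonzero up to [m], a contradiction. So
    the nucleus is above [ael m], which then labels no cover above it. In the converse, the nucleus
    is strictly below [ael m], and join-irreducibility makes [ael m] the label of a cover ending at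
    [ael m]. *)
Lemma ael_core_label u m : (ael m \in core_label_set u) = (m \in alabels u).
Proof.
apply/idP/alabelsP; rewrite inE.
  case/existsP => b /existsP[b' /and4P[xb bb' b'u /andP[/eqP ba _]]].
  have au : (ael m <= u)%O by apply: le_trans b'u; rewrite -ba leUr.
  split=> [|j mj]; first exact/ael_leP.
  apply/negP => /eqP uj; have /andP[] := bb'; rewrite -ba lt_neqAle => /andP[/negP]; case.
  suff ax : (ael m <= nucleus u)%O by rewrite eq_sym join_l // (le_trans ax).
  rewrite lexI au; apply: meets_ge => w /andP[ltw nw].
  apply: contraT => aw.
  have wa : (w `|` ael m)%O = u.
    apply/eqP; apply: contraR nw => ne; apply/existsP; exists (w `|` ael m)%O.
    rewrite [(_ < u)%O]lt_neqAle ne leUx (ltW ltw) au lt_neqAle leUl !andbT.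
    by apply: contra aw => /eqP->; rewrite leUr.
  have wj : w j = 1 :> nat.
    have := congr1 (fun v : Hoch N.+1 => nat_of_ord (v j)) wa.
    by rewrite joinE aelE leqNgt mj maxn0 uj.
  case/negP: aw; apply/ael_leP => i im; apply: entry_before_one wj; exact: leq_trans im (ltnW mj).
case=> h0 h1; set x := nucleus u.
have xu : (x <= u)%O by apply: leIl.
have ltx : (x < ael m)%O.
  have x1 j : x j <= 1.
    have [/nucleus_two //|] := (u j : nat) =P 2.
    by have := entry_le2 u j; have /Hoch_leP/(_ j) := xu; lia.
  (* The witness is the position of the last 1, which [h1] puts at or before [m]. Such a 1 exists:
     [h0] excludes a 0 at position 0, and (T2) excludes a 2 there. *)
  have [k km xk] : exists2 k : I, k <= m & x k = 0 :> nat.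
    rewrite /x; elim/Hoch_ind: u h0 h1 {x xu x1} => C [k|] C0 /= kC h0 h1.
      exists k; last exact: nucleus_last.
      by rewrite leqNgt; apply/negP => /h1; rewrite wordE // (negbTE kC) /= leqnn.
    by have := h0 ord0 (leq0n _); rewrite wordE // (negbTE C0).
  rewrite lt_neqAle; apply/andP; split.
    by apply/eqP => /(congr1 (fun u : Hoch N.+1 => nat_of_ord (u k))); rewrite xk aelE km.
  apply/Hoch_leP => j; rewrite aelE; case: (leqP j m) => // mj.
  have := @entry_before_one x k j; rewrite xk => /(_ (leq_trans km (ltnW mj))).
  by have := x1 j; lia.
have [b xb bm] := lower_cover ltx; have /andP[ltb nb] := bm.
apply/existsP; exists b; apply/existsP; exists (ael m); rewrite xb bm /=.
apply/andP; split; first exact/ael_leP.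
rewrite /is_label join_r ?ltW // eqxx /=; apply/forall_inP => c /eqP.
by case/ael_join_irreducible => [bE|-> //]; rewrite bE ltxx in ltb.
Qed.

Lemma CLO_le_labels (u v : CLO N.+1) :
  (u <= v)%O = (blabels u \subset blabels v) && (alabels u \subset alabels v).
Proof.
rewrite CLO_leE; apply/subsetP/andP => [uv|[/subsetP uv2 /subsetP uva] c cu].
  split; apply/subsetP => i iu; last by rewrite -ael_core_label uv ?ael_core_label.
  have i0 : i != ord0 by apply: contraTneq iu => ->; rewrite inE entry_0.
  by rewrite -bel_core_label // uv ?bel_core_label.
have [[m E]|[i i0 E]] := core_label_ael_bel cu; move: cu; rewrite E.
  by rewrite !ael_core_label; apply: uva.
by rewrite !bel_core_label //; apply: uv2.
Qed.

End Words.

(** * The core label order and its rank function in terms of codes *)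

Section CoreLabelOrder.
Variable N : nat.
Notation I := 'I_N.+1.
Implicit Types (C B : {set I}) (m k : I) (o : option I).

Definition last_notin C m : I := [arg max_(k > ord0 | (k \notin C) && (k <= m)) (k : nat)].

Lemma last_notin_eqP C m k : ord0 \notin C ->
  reflect [/\ k \notin C, k <= m & forall j : I, k < j -> j <= m -> j \in C] (last_notin C m == k).
Proof.
move=> C0; rewrite /last_notin; case: arg_maxnP => [|k' /andP[k'C k'm] k'max]; first by rewrite C0.
apply: (iffP eqP) => [<-|[kC km kmax]].
  split=> // j kj jm; apply: contraLR kj => jC; rewrite -leqNgt.
  by apply: k'max; rewrite jC.
have kk' : k <= k' by apply: k'max; rewrite kC.
apply/val_inj/eqP; rewrite eqn_leq kk' andbT leqNgt; apply/negP => kk.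
by rewrite (kmax _ kk k'm) in k'C.
Qed.

Lemma last_notin_notin C m : ord0 \notin C -> last_notin C m \notin C.
Proof. by move=> C0; case: (last_notin_eqP m (last_notin C m) C0 _) => //; rewrite eqxx. Qed.

Lemma last_notin_id C m : ord0 \notin C -> m \notin C -> last_notin C m = m.
Proof.
move=> C0 mC; apply/eqP/(last_notin_eqP _ _ C0); split=> // j mj jm.
by move: mj; rewrite ltnNge jm.
Qed.

(** The positions skipped between [last_notin C m] and [m] lie in [C], hence in [B]. *)
Lemma last_notin_twice C B m : ord0 \notin B -> C \subset B ->
  last_notin B (last_notin C m) = last_notin B m.
Proof.
move=> B0 CB; have C0 : ord0 \notin C by apply: contra B0; apply: (subsetP CB).
have [kC km kmax] := last_notin_eqP m _ C0 (eqxx _).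
have [lB lk lmax] := last_notin_eqP (last_notin C m) _ B0 (eqxx _).
apply/esym/eqP/(last_notin_eqP _ _ B0); split=> //; first exact: leq_trans lk km.
move=> j lj jm; case: (leqP j (last_notin C m)) => [jk|kj]; first exact: lmax.
exact/(subsetP CB)/kmax.
Qed.

Lemma blabels_word C o : ord0 \notin C -> oapp (fun k => k \notin C) true o ->
  blabels (word C o) = C.
Proof. by move=> C0 oC; have /(congr1 fst) := @wordK _ (C, o) (introT andP (conj C0 oC)). Qed.

(** For [o = Some k], the two conditions of [alabelsP] say that the last 1 is at [k <= m] and that
    only entries 2 occur from there up to [m]. *)
Lemma alabels_word C o m : ord0 \notin C -> oapp (fun k => k \notin C) true o ->
  (m \in alabels (word C o)) = (Some (last_notin C m) == o).
Proof.
move=> C0; case: o => [k|] /= kC.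
  rewrite (inj_eq (@Some_inj _)).
  apply/alabelsP/(last_notin_eqP _ _ C0) => [[h0 h1]|[_ km kmax]].
    have km : k <= m.
      by rewrite leqNgt; apply/negP => /h1; rewrite wordE // (negbTE kC) /= leqnn.
    split=> // j kj jm; have := h0 j jm; rewrite wordE //.
    by case: ifP => // _; rewrite /= leqNgt kj.
  split=> j.
    move=> jm; rewrite wordE //; case: ifP => // /negbT jC /=.
    by case: leqP => // kj; rewrite (kmax j kj jm) in jC.
  move=> mj; rewrite wordE //; case: ifP => // _ /=.
  by rewrite leqNgt (leq_ltn_trans km mj).
apply/negP => /alabelsP[/(_ ord0 (leq0n _))].
by rewrite wordE // (negbTE C0).
Qed.

Definition code_le (p q : {set I} * option I) : bool :=
  (p.1 \subset q.1) && oapp (fun k => Some (last_notin q.1 k) == q.2) true p.2.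

(** The inclusion of the a-labels need only be tested at [k], which is itself a label because it
    lies outside [C]; [last_notin_twice] carries it to the other labels. *)
Lemma word_CLO_le p q : p \in @codes N -> q \in @codes N ->
  ((word p.1 p.2 : CLO N.+1) <= word q.1 q.2)%O = code_le p q.
Proof.
case: p q => [C o] [B o'] /andP[/= C0 oC] /andP[/= B0 oB].
rewrite CLO_le_labels !blabels_word // /code_le /=; case: (boolP (C \subset B)) => //= CB.
case: o oC => [k|] /= kC.
  apply/subsetP/eqP => [/(_ k)|<- m].
    by rewrite !alabels_word //= last_notin_id // eqxx => /(_ isT)/eqP.
  have lB := last_notin_notin k B0.
  by rewrite !alabels_word //= => /eqP[<-]; rewrite last_notin_twice.
by apply/subsetP => m; rewrite alabels_word.
Qed.

Lemma code_CLO_le (u v : CLO N.+1) : (u <= v)%O = code_le (code u) (code v).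
Proof. by rewrite -word_CLO_le ?code_codes // !codeK. Qed.

Definition rk (u : Hoch N.+1) : nat := #|(code u).1| + isSome (code u).2.

Lemma rk_word p : p \in @codes N -> rk (word p.1 p.2) = #|p.1| + isSome p.2.
Proof. by move=> pc; rewrite /rk wordK. Qed.

Lemma rk_covers (u v : CLO N.+1) : covers u v -> rk v = (rk u).+1.
Proof.
rewrite -(codeK u) -(codeK v); have := code_codes v; have := code_codes u.
move: (code u) (code v) => [C o] [B o'] Cc Bc /andP[ltuv nuv].
have /andP[/= C0 oC] := Cc; have /andP[/= B0 oB] := Bc.
have : code_le (C, o) (B, o') by rewrite -word_CLO_le //; apply: ltW.
case/andP => /= CB oo'; rewrite (@rk_word (C, o)) // (@rk_word (B, o')) //=.
case: (eqVneq C B) => [EC|neCB].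
  rewrite -EC in oo' oB ltuv *; case: o oC oo' ltuv {Cc nuv} => [k|] /= kC; last first.
    by case: (o') => [k|]; rewrite ?ltxx //= addn0 addn1.
  by rewrite last_notin_id // => /eqP<-; rewrite ltxx.
have /properP[_ [i iB iC]] : C \proper B by rewrite properEneq neCB.
have D0 : ord0 \notin i |: C.
  by rewrite !inE negb_or C0 andbT; apply: contraNneq B0 => ->.
(* Adding a single element of [B] to [C] and moving [o] accordingly gives an element of rank one
   more that lies between the two, so a cover must end there. *)
pose w := (i |: C, omap (last_notin (i |: C)) o).
have wc : w \in @codes N.
  by rewrite inE /= D0 /=; case: (o) => //= k; apply: last_notin_notin.
have DB : i |: C \subset B by rewrite subUset sub1set iB.
have lew : (word C o <= word w.1 w.2 :> CLO N.+1)%O.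
  rewrite (@word_CLO_le (C, o) w) // /code_le /= subsetUr /=.
  by case: (o) => //= k.
have wle : (word w.1 w.2 <= word B o' :> CLO N.+1)%O.
  rewrite (@word_CLO_le w (B, o')) // /code_le /= DB /=.
  by case: (o) oo' => //= k; rewrite last_notin_twice.
have rkw : rk (word w.1 w.2) = (#|C| + isSome o).+1.
  by rewrite rk_word //= cardsU1 iC; case: (o).
suff E : word w.1 w.2 = word B o' by rewrite -(@rk_word (B, o')) //= -E.
apply/eqP; apply: contraR nuv => ne; apply/existsP; exists (word w.1 w.2 : CLO N.+1).
rewrite !lt_neqAle lew wle ne /= !andbT; apply/eqP => /(congr1 rk).
by rewrite rkw (@rk_word (C, o)) //; apply: n_Sn.
Qed.

Lemma rankE (u : CLO N.+1) : rank u = rk u.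
Proof.
have bc : ((set0 : {set I}), None) \in @codes N by rewrite !inE.
apply: esym; apply: (@rank_unique _ (CLO N.+1) (word set0 None) (@rk)) => [v||v w];
  last exact: rk_covers.
  rewrite code_CLO_le (@wordK _ (set0, None)) // /code_le /= sub0set.
  by [].
by rewrite (@rk_word (set0, None)) //= cards0.
Qed.

Lemma sum_Hoch (V : nmodType) (F : Hoch N.+1 -> V) :
  (\sum_u F u = \sum_(C : {set I} | ord0 \notin C)
     (F (word C None) + \sum_(k | k \notin C) F (word C (Some k))))%R.
Proof.
rewrite (reindex_onto (fun p => word p.1 p.2) (@code _)) => [|u _]; last exact: codeK.
rewrite (eq_bigl (fun p : {set I} * option I =>
  (ord0 \notin p.1) && oapp (fun k => k \notin p.1) true p.2)); last first.
  move=> p; apply/eqP/idP => [<-|]; first exact: code_codes.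
  exact: wordK.
rewrite -(pair_big_dep (fun C : {set I} => ord0 \notin C)
  (fun (C : {set I}) o => oapp (fun k => k \notin C) true o)
  (fun C o => F (word C o))) /=.
apply: eq_bigr => C C0.
rewrite (bigD1 None) //=; congr (_ + _)%R.
rewrite (reindex_omap Some id) => [|[k|] //].
by apply: eq_bigl => k; rewrite /= eqxx !andbT.
Qed.

End CoreLabelOrder.

(** * Comparabilities, atoms and antichains of the poset of join-irreducibles *)

Section Antichains.
Variable N : nat.
Notation I := 'I_N.+1.
Implicit Types (i k l : I) (E : {set I}).

Lemma ael_irr k : join_irreducible (ael k).
Proof.
apply/andP; split.
  apply/eqP => /(congr1 (fun u : Hoch N.+1 => nat_of_ord (u k))).
  by rewrite aelE leqnn ffunE inordK.
apply/forallP => b; apply/forallP => c; apply/implyP => /eqP /ael_join_irreducible.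
by case=> ->; rewrite eqxx ?orbT.
Qed.

Lemma bel_irr i : i != ord0 -> join_irreducible (bel i).
Proof.
move=> i0; apply/andP; split.
  apply/eqP => /(congr1 (fun u : Hoch N.+1 => nat_of_ord (u i))).
  by rewrite belE // eqxx ffunE inordK.
apply/forallP => b; apply/forallP => c; apply/implyP => /eqP bc.
have bi : (b <= bel i)%O by rewrite -bc leUl.
have ci : (c <= bel i)%O by rewrite -bc leUr.
have : (bel i <= b `|` c)%O by rewrite bc.
rewrite !eq_le bi ci !bel_le // joinE.
by rewrite /maxn; case: ifP => _ ->; rewrite ?orbT.
Qed.

Definition ja k : Jposet N.+1 := JIrr (ael_irr k).
(** [jb ord0] is a junk value. *)
Definition jb i : Jposet N.+1 := insubd (ja ord0) (bel i).

Lemma jbE i : i != ord0 -> jval (jb i) = bel i.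
Proof. by move=> i0; rewrite [LHS]val_insubd bel_irr. Qed.

Lemma Jposet_ja_jb (j : Jposet N.+1) :
  (exists k, j = ja k) \/ (exists2 i, i != ord0 & j = jb i).
Proof.
have [[k E]|[i i0 E]] := join_irreducible_ael_bel (valP j).
  by left; exists k; apply/val_inj.
by right; exists i => //; apply/val_inj; rewrite /= jbE.
Qed.

Lemma ja_le k l : (ja k <= ja l)%O = (k <= l).
Proof.
rewrite Jposet_leE; case: (boolP (is_b 2 _)) => [/forallP/(_ ord0)|_].
  by rewrite aelE.
rewrite orbF; apply/ael_leP/idP => [/(_ k (leqnn k))|kl j jk].
  by rewrite aelE; case: (k <= l).
by rewrite aelE (leq_trans jk kl).
Qed.

Lemma ja_inj : injective ja.
Proof. by move=> k l E; apply/val_inj/eqP; rewrite eqn_leq -!ja_le E lexx. Qed.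

Lemma ja_le_jb k i : i != ord0 -> (ja k <= jb i)%O = false.
Proof.
move=> i0; rewrite Jposet_leE jbE //.
apply/negP => /orP[/Hoch_leP/(_ ord0)|/andP[/forallP/(_ ord0)]].
  by rewrite aelE belE // [ord0 == i]eq_sym (negbTE i0).
by rewrite aelE.
Qed.

(** The entry 2 of [bel i] rules out the componentwise order, so only the added relations remain;
    counting positions from 0 turns b^(2) into [i = 1] and a^(m) with [m > 1] into [k != ord0]. *)
Lemma jb_le_ja i k : i != ord0 -> (jb i <= ja k)%O = (i == 1 :> nat) && (k != ord0).
Proof.
move=> i0; rewrite Jposet_leE jbE // bel_le // aelE.
have -> : ((i <= k) == 2 :> nat) = false by case: (i <= k).
congr (_ && _).
  apply/forallP/eqP => [/(_ i)|i1 j]; rewrite belE //.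
    by rewrite eqxx eqSS; case: (i =P 1 :> nat).
  by rewrite -val_eqE /= i1 eqSS.
apply/existsP/idP => [[m /andP[m1 /forallP am]]|k0].
  have N1 : 1 < N.+1 by apply: leq_trans m1 _; rewrite -ltnS.
  have := am (Ordinal N1); rewrite aelE /= m1.
  by apply: contraL => /eqP->.
have kN : k.+1 < N.+2 by rewrite ltnS.
exists (Ordinal kN); rewrite /= ltnS lt0n k0; apply/forallP => j.
by rewrite aelE /= ltnS; case: (j <= k).
Qed.

Lemma jb_le i l : i != ord0 -> l != ord0 -> (jb i <= jb l)%O = (i == l).
Proof.
move=> i0 l0; rewrite Jposet_leE !jbE // bel_le // belE //.
case: (boolP [exists _, _]) => [/existsP[m /andP[m1 /forallP/(_ ord0)]]|_].
  by rewrite belE // [ord0 == l]eq_sym (negbTE l0) (ltn_trans _ m1).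
by rewrite andbF orbF; case: (i == l).
Qed.

Lemma jb_inj : {in [set~ ord0 : I] &, injective jb}.
Proof.
by move=> i l; rewrite !inE => i0 l0 E; apply/eqP; rewrite -jb_le // E lexx.
Qed.

Lemma ja_neq_jb k i : i != ord0 -> ja k <> jb i.
Proof. by move=> i0 E; have := ja_le_jb k i0; rewrite E lexx. Qed.

Lemma lt_ael k (w : Hoch N.+1) : (w < ael k)%O -> w k = 0 :> nat.
Proof.
move=> wk; have /Hoch_leP/(_ k) := ltW wk; rewrite aelE leqnn.
case E: (nat_of_ord (w k)) => [//|[|//]] _; have := lt_geF wk.
by move/negP; case; apply/ael_leP => j jk; apply: entry_before_one jk E.
Qed.

Lemma atom_ja k : (ja k \in Atom N.+1) = (k == ord0).
Proof.
have posa l : (\bot < ael l)%O by rewrite lt0x; case/andP: (ael_irr l).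
rewrite inE /atom /covers posa /=; case: eqP => [->|/eqP k0].
  apply/existsP => -[w /andP[w0 wa]]; move: w0; rewrite lt0x => /eqP; case.
  apply: Hoch_eqP => i; rewrite ffunE inordK //.
  have [->|i0] := eqVneq i ord0; first exact: lt_ael.
  have /Hoch_leP/(_ i) := ltW wa.
  by rewrite aelE leqn0 -[i == 0 :> nat]/(i == ord0) (negbTE i0) leqn0 => /eqP.
apply/negbTE; rewrite negbK; apply/existsP; exists (ael ord0); rewrite posa /=.
rewrite lt_leAnge; apply/andP; split.
  by apply/ael_leP => j; rewrite leqn0 => /eqP j0; rewrite aelE j0.
apply/negP => /ael_leP/(_ k (leqnn k)).
by rewrite aelE leqn0 -[k == 0 :> nat]/(k == ord0) (negbTE k0).
Qed.

Lemma atom_jb i : i != ord0 -> jb i \in Atom N.+1.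
Proof.
move=> i0; rewrite inE /atom /covers jbE // lt0x; case/andP: (bel_irr i0) => -> _ /=.
apply/existsP => -[w /andP[w0 wb]]; move: w0; rewrite lt0x => /eqP; case.
have wj j : j != i -> w j = 0 :> nat.
  by move=> ji; have /Hoch_leP/(_ j) := ltW wb; rewrite belE // (negbTE ji) leqn0 => /eqP.
apply: Hoch_eqP => j; rewrite ffunE inordK //.
have [->|/wj //] := eqVneq j i.
have := lt_geF wb; rewrite bel_le // => wi2.
have w00 : w ord0 = 0 :> nat by apply: wj; rewrite eq_sym.
(* The value 1 at [i] is excluded by the 0 at position 0, so no triword lies strictly between the
   bottom and [bel i]. *)
have := @entry_before_one _ w ord0 i (leq0n _); rewrite w00.
by have := entry_le2 w i; move: wi2; case: (nat_of_ord (w i)) => [|[|[|]]] // _ _ /(_ erefl).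
Qed.

(** The indices of the b-elements incomparable to [ja k]. *)
Definition allowed k : {set I} :=
  [set i : I | (i != ord0) && ((k == ord0) || (i != 1 :> nat))].

Lemma card_allowed k : #|allowed k| = if k == ord0 then N else N.-1.
Proof.
case: eqP => [->|/eqP k0].
  have -> : allowed ord0 = [set~ ord0] by apply/setP => i; rewrite !inE eqxx andbT.
  by rewrite cardsC1 card_ord.
have k1 : 0 < k by rewrite lt0n.
have N1 : 1 < N.+1 by apply: leq_ltn_trans k1 (ltn_ord k).
have -> : allowed k = [set~ ord0] :\ Ordinal N1.
  by apply/setP => i; rewrite !inE (negbTE k0) andbC.
have := congr1 predn (cardsD1 (Ordinal N1) [set~ ord0]).
by rewrite cardsC1 card_ord in_setC in_set1 => ->.
Qed.

Lemma antichain_no_a (A : {set Jposet N.+1}) :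
  antichain A && ([pick k | ja k \in A] == None) = (A \subset jb @: [set~ ord0]).
Proof.
apply/andP/subsetP => [[_]|h].
  case: pickP => // noa _ j jA; have [[k E]|[i i0 ->]] := Jposet_ja_jb j.
    by have := noa k; rewrite -E jA.
  by apply: imset_f; rewrite !inE.
split.
  apply/forall_inP => a /h/imsetP[i]; rewrite !inE => i0 ->.
  apply/forall_inP => b /h/imsetP[l]; rewrite !inE => l0 ->.
  by rewrite jb_le //; apply/implyP => /eqP->.
case: pickP => // k /h/imsetP[i]; rewrite !inE => i0 E.
by case: (ja_neq_jb i0 E).
Qed.

(** The left side is the condition produced by reindexing along the removal of [ja k]. The
    a-elements form a chain, so no second one can occur, while the b-elements are pairwise
    incomparable. *)
Lemma antichain_one_a k (A : {set Jposet N.+1}) :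
  [&& antichain (ja k |: A), [pick l | ja l \in ja k |: A] == Some k
    & (ja k |: A) :\ ja k == A] = (A \subset jb @: allowed k).
Proof.
apply/and3P/subsetP => [[anti _ /eqP kA] j jA|h].
  have kA' : ja k \notin A by rewrite -kA !inE eqxx.
  have incomp a b : a \in ja k |: A -> b \in ja k |: A -> (a <= b)%O -> a = b.
    by move=> aA bA ab; apply/eqP/(implyP (forall_inP (forall_inP anti a aA) b bA)).
  have kU : ja k \in ja k |: A by rewrite setU11.
  have jU : j \in ja k |: A by rewrite inE jA orbT.
  have [[l E]|[i i0 E]] := Jposet_ja_jb j.
    suff jk : j = ja k by rewrite -jk jA in kA'.
    case/orP: (leq_total k l) => kl; last by apply: incomp; rewrite // E ja_le.
    by apply/esym/incomp; rewrite // E ja_le.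
  rewrite E; apply: imset_f; rewrite inE i0 /= -[_ || _]negbK negb_or negbK.
  apply/negP => /andP[k0 i1]; apply: (@ja_neq_jb k i i0).
  by rewrite -E; apply/esym/incomp; rewrite // E jb_le_ja // i1.
have kA : ja k \notin A.
  by apply/negP => /h/imsetP[i]; rewrite inE => /andP[i0 _]; apply: ja_neq_jb.
split; last by rewrite setU1K.
  apply/forall_inP => a; rewrite !inE => /orP[/eqP->|/h/imsetP[i]].
    apply/forall_inP => b; rewrite !inE => /orP[/eqP->|/h/imsetP[l]]; first by rewrite eqxx implybT.
    by rewrite inE => /andP[l0 _] ->; rewrite ja_le_jb.
  rewrite inE => /andP[i0 ki] ->.
  apply/forall_inP => b; rewrite !inE => /orP[/eqP->|/h/imsetP[l]].
    by rewrite jb_le_ja //; case/orP: ki => [->|/negbTE->]; rewrite ?andbF.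
  by rewrite inE => /andP[l0 _] ->; rewrite jb_le //; apply/implyP => /eqP->.
case: pickP => [l|/(_ k)]; last by rewrite setU11.
rewrite !inE => /orP[/eqP/ja_inj->//|/h/imsetP[i]].
by rewrite inE => /andP[i0 _] E; case: (ja_neq_jb i0 E).
Qed.

End Antichains.

(** * Inversion of the zeta function and sums over subsets *)

Local Open Scope ring_scope.

(** The recursion makes [mobius] a left inverse of the zeta function, and the hypothesis makes [f] a
    right inverse; evaluating the triple product in two ways identifies them. *)
Lemma mobius_eq d (T : finPOrderType d) (f : T -> T -> int) :
    (forall u v, \sum_(w | (u <= w)%O) f w v = (u == v)%:R) ->
  @mobius d T =2 f.
Proof.
move=> zetaf u v.
have muzeta w : \sum_(t | (t <= w)%O) mobius u t = (u == w)%:R.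
  rewrite (bigID (fun t => (u <= t)%O)) /= [X in _ + X]big1 ?addr0; last first.
    move=> t /andP[_ ut]; rewrite mobiusE; case: eqP => [E|_].
      by rewrite E lexx in ut.
    by rewrite lt_neqAle (negbTE ut) andbF.
  case: (boolP (u <= w)%O) => [uw|nuw]; last first.
    rewrite big1 => [|t /andP[tw ut]]; last by rewrite (le_trans ut tw) in nuw.
    by case: eqP => // E; rewrite E lexx in nuw.
  rewrite (bigD1 w) /=; last by rewrite lexx.
  rewrite (eq_bigl (fun t => (u <= t < w)%O)); last first.
    by move=> t; rewrite lt_neqAle; case: (t <= w)%O; case: (t != w); case: (u <= t)%O.
  rewrite mobiusE; case: eqP => [<-|/eqP ne].
    rewrite big1 ?addr0 // => t /andP[ut tu].
    by have := le_lt_trans ut tu; rewrite ltxx.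
  by rewrite lt_neqAle ne uw addNr.
transitivity (\sum_t mobius u t * \sum_(w | (t <= w)%O) f w v).
  rewrite (bigD1 v) //= zetaf eqxx mulr1 big1 ?addr0 // => t tv.
  by rewrite zetaf (negbTE tv) mulr0.
transitivity (\sum_w (\sum_(t | (t <= w)%O) mobius u t) * f w v).
  under eq_bigr do rewrite big_distrr /=.
  rewrite (exchange_big_dep xpredT) //=; apply: eq_bigr => w _.
  by rewrite big_distrl.
rewrite (bigD1 u) //= muzeta eqxx mul1r big1 ?addr0 // => w wu.
by rewrite muzeta eq_sym (negbTE wu) mul0r.
Qed.

Lemma sum_subset_prod (R : comPzRingType) (T : finType) (D : {set T}) (F : T -> R) :
  \sum_(J : {set T} | J \subset D) \prod_(i in J) F i = \prod_(i in D) (1 + F i).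
Proof.
rewrite [RHS]big_mkcond /=.
transitivity (\prod_i ((if i \in D then F i else 0) + 1)); last first.
  by apply: eq_bigr => i _; case: ifP => _; rewrite ?add0r // addrC.
rewrite bigA_distr big_mkcond; apply: eq_bigr => J _.
rewrite -big_mkcond /=; case: ifP => [/subsetP JD|/negbT/subsetPn[i iJ iD]].
  by apply: eq_bigr => i /JD->.
by rewrite (bigD1 i) //= (negbTE iD) mul0r.
Qed.

(** The sum factors over the elements of [T]. At [i] the first summand stands for [i \in J] and the
    second for [i \notin J]; their sum vanishes exactly where [A] and [B] differ. *)
Lemma sum_interval_sign (R : comPzRingType) (T : finType) (A B : {set T}) :
  \sum_(J : {set T} | (A \subset J) && (J \subset B)) (-1) ^+ (#|B| + #|J|)
    = (A == B)%:R :> R.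
Proof.
transitivity (\prod_(i in B) (-1 : R) *
              \prod_i ((if i \in B then -1 else 0) + (if i \in A then 0 else 1)) : R).
  rewrite bigA_distr big_distrr /= big_mkcond; apply: eq_bigr => J _.
  case: ifP => [/andP[AJ JB]|/negbT].
    rewrite exprD; congr (_ * _); first by rewrite prodr_const.
    rewrite -prodr_const big_mkcond; apply: eq_bigr => i _.
    case: ifP => [/(subsetP JB)->//|/negbT iJ].
    by rewrite ifN //; apply: contra iJ; apply: (subsetP AJ).
  rewrite negb_and => /orP[/subsetPn[i iA iJ]|/subsetPn[i iJ iB]].
    by rewrite [X in _ * X](bigD1 i) //= (negbTE iJ) iA mul0r mulr0.
  by rewrite [X in _ * X](bigD1 i) //= iJ (negbTE iB) mul0r mulr0.
case: eqP => [->|/eqP ne].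
  rewrite big_mkcond -big_split big1 // => i _ /=.
  by case: ifP => _; rewrite ?addr0 ?add0r ?mulr1 // mulrNN mulr1.
have [i iAB] : exists i, (i \in A) != (i \in B).
  apply/existsP; apply: contraR ne; rewrite negb_exists => /forallP h.
  by apply/eqP/setP => i; apply/eqP; rewrite -[_ == _]negbK h.
rewrite [X in _ * X](bigD1 i) //=; move: iAB.
by case: (i \in A); case: (i \in B) => // _; rewrite ?addr0 ?addNr mul0r mulr0.
Qed.

(** * The Moebius function of the core label order *)

Section Moebius.
Variable N : nat.
Notation I := 'I_N.+1.
Implicit Types (C B : {set I}) (m k : I) (o : option I).

Definition mob (p q : {set I} * option I) : int :=
  if p.1 \subset q.1 then
    (-1) ^+ (#|q.1| + #|p.1|) *
    match p.2, q.2 with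
    | None, None => 1
    | Some m, Some k => (last_notin q.1 m == k)%:R
    | Some _, None => 0
    | None, Some k => - \sum_(m | m \notin p.1) (last_notin q.1 m == k)%:R
    end
  else 0.

Lemma mobius_CLO (u v : CLO N.+1) : mobius u v = mob (code u) (code v).
Proof.
apply: (mobius_eq (f := fun u v : CLO N.+1 => mob (code u) (code v))) => {}u {}v.
rewrite -(inj_eq (@code_inj N)).
under eq_bigl do rewrite code_CLO_le.
rewrite big_mkcond (@sum_Hoch N _ (fun w => if code_le (code u) (code w)
                                     then mob (code w) (code v) else 0)) /=.
under eq_bigr => C C0.
  rewrite (@wordK _ (C, None)) ?inE ?C0 //.
  under eq_bigr => k kC do rewrite (@wordK _ (C, Some k)) ?inE ?C0 //.
  over.
have := code_codes v; have := code_codes u.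
move: (code u) (code v) => [B p] [B' q] /andP[/= B0 pB] /andP[/= B'0 qB'].
(* For each [C] between [B] and [B'], the codes with first component [C] above [(B, p)] contribute a
   sign times this [c], which does not depend on [C]. *)
pose c : int := match p, q with
  | None, None => 1 | Some j, Some k => (last_notin B' j == k)%:R | _, _ => 0 end.
transitivity (\sum_(C : {set I} | (B \subset C) && (C \subset B'))
                 (-1) ^+ (#|B'| + #|C|) * c); last first.
  rewrite -big_distrl /= sum_interval_sign xpair_eqE /c {c}.
  case: eqP => [EB|_]; last by rewrite mul0r.
  rewrite mul1r /=; case: p q pB qB' => [j|] [k|] //= jB _.
  by rewrite -EB last_notin_id.
rewrite big_mkcond [RHS]big_mkcond /=; apply: eq_bigr => C _.
case: (boolP (ord0 \notin C)) => C0; last first.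
  by case: ifP => // /andP[_ /subsetP/(_ ord0)]; rewrite (negbNE C0) (negbTE B'0) => /(_ isT).
rewrite /code_le /mob /=; case: (boolP (B \subset C)) => BC /=; last first.
  by rewrite add0r big1.
case: (boolP (C \subset B')) => CB'; last first.
  by rewrite if_same add0r big1 // => k _; rewrite if_same.
(* With [p = None] every second component occurs, and the [Some] terms cancel the [None] term if [q]
   is a [Some]. With [p = Some j] only [Some (last_notin C j)] occurs. *)
rewrite /c {c}; case: p pB => [j|] /= jB; last first.
  rewrite -big_distrr -mulrDr /=; congr (_ * _).
  by case: q qB' => [k|] //= _; rewrite ?addNr // big1 ?addr0.
rewrite add0r (bigD1 (last_notin C j)) /= ?last_notin_notin // eqxx big1 ?addr0.
  by case: q qB' => [k|] //= _; rewrite last_notin_twice.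
by move=> k /andP[_ ne]; rewrite (inj_eq (@Some_inj _)) eq_sym (negbTE ne).
Qed.

End Moebius.

(** This is [sum_subset_prod] twice: the inner sum becomes the product of the [1 - a i] over [B],
    and each such factor absorbs one [- y]. *)
Lemma sum_nested_subset_prod (R : comPzRingType) (T : finType) (D : {set T}) (a : T -> R) y :
  \sum_(B : {set T} | B \subset D) \sum_(C : {set T} | C \subset B)
    (-1) ^+ (#|B| + #|C|) * (\prod_(i in C) a i) * y ^+ #|B|
  = \prod_(i in D) (1 + y * (a i - 1)).
Proof.
rewrite -sum_subset_prod; apply: eq_bigr => B _.
transitivity ((\sum_(C : {set T} | C \subset B) \prod_(i in C) - a i) * (- y) ^+ #|B|).
  rewrite big_distrl /=; apply: eq_bigr => C _.
  by rewrite prodrN exprD [(- y) ^+ _]exprNn; ring.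
rewrite sum_subset_prod -prodr_const -big_split /=.
by apply: eq_bigr => i _; ring.
Qed.

(** * The M-triangle in closed form *)

Section MTriangle.
Variables (N : nat) (F : fieldType) (x y : F).
Notation I := 'I_N.+1.

Lemma M_triangle_pairs : M_triangle N.+1 x y =
  \sum_(B : {set I} | B \subset [set~ ord0]) \sum_(C : {set I} | C \subset B)
    (-1) ^+ (#|B| + #|C|) * x ^+ #|C| * y ^+ #|B| *
    (1 + \sum_(m | m \notin C) (x - 1) * y).
Proof.
pose W (p q : {set I} * option I) : F := (mob p q)%:~R * x ^+ (#|p.1| + isSome p.2) *
  y ^+ (#|q.1| + isSome q.2).
transitivity (\sum_(u : Hoch N.+1) \sum_(v : Hoch N.+1) W (code u) (code v)).
  by apply: eq_bigr => u _; apply: eq_bigr => v _; rewrite mobius_CLO !rankE.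
have sum_code (G : {set I} * option I -> F) : \sum_u G (code u) =
    \sum_(C : {set I} | ord0 \notin C) (G (C, None) + \sum_(k | k \notin C) G (C, Some k)).
  rewrite (@sum_Hoch N _ (fun u => G (code u))); apply: eq_bigr => C C0.
  rewrite (@wordK _ (C, None)) ?inE ?C0 //; congr (_ + _); apply: eq_bigr => k kC.
  by rewrite (@wordK _ (C, Some k)) ?inE ?C0.
rewrite (sum_code (fun p => \sum_v W p (code v))).
under eq_bigr => C C0.
  rewrite sum_code; under [X in _ + X]eq_bigr do rewrite sum_code.
  rewrite exchange_big /= -big_split /=; over.
rewrite exchange_big /=; apply: eq_big => [B|B B0]; first by rewrite subsetC sub1set inE.
rewrite big_mkcond [RHS]big_mkcond /=; apply: eq_bigr => C _.
case: (boolP (C \subset B)) => CB; last first.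
  have W0 o o' : W (C, o) (B, o') = 0 by rewrite /W /mob (negbTE CB) mulr0z !mul0r.
  case: ifP => // _; rewrite W0 add0r !big1 ?addr0 // => k _.
  by rewrite W0 add0r big1.
rewrite /W /mob /= CB.
have -> : ord0 \notin C by apply: contra B0; apply: (subsetP CB).
set s := (-1) ^+ _; rewrite !addn0 !addn1 mulr1 mulr0 !exprS.
pose w : F := (-1) ^+ (#|B| + #|C|) * x ^+ #|C| * y ^+ #|B|.
have sE : s%:~R = (-1) ^+ (#|B| + #|C|) :> F by rewrite /s rmorphXn rmorphN1.
(* The three summands come from the second components ([None], [None]), ([None], [Some]) and
   ([Some], [Some]); the remaining combination contributes 0. *)
transitivity (w + (\sum_(k | k \notin B) \sum_(m | m \notin C) - (w * y * (last_notin B m == k)%:R))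
   + \sum_(m | m \notin C) \sum_(k | k \notin B) w * x * y * (last_notin B m == k)%:R).
  congr (_ + _ + _); first by rewrite sE.
    apply: eq_bigr => k _; rewrite rmorphM rmorphN rmorph_sum /= sE mulrN !mulNr.
    rewrite big_distrr !big_distrl /= -sumrN; apply: eq_bigr => m _.
    by rewrite rmorph_nat /w; ring.
  apply: eq_bigr => m _; rewrite !mul0r add0r; apply: eq_bigr => k _.
  by rewrite rmorphM rmorph_nat /= sE /w; ring.
have one m : \sum_(k | k \notin B) (last_notin B m == k)%:R = 1 :> F.
  rewrite (bigD1 (last_notin B m)) ?last_notin_notin //= eqxx big1 ?addr0 // => k /andP[_ ne].
  by rewrite eq_sym (negbTE ne).
rewrite exchange_big /= -addrA -big_split /= mulrDr mulr1 big_distrr /=; congr (_ + _).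
apply: eq_bigr => m _; rewrite sumrN -!big_distrr /= one; rewrite -/w; ring.
Qed.

Lemma M_triangleE : M_triangle N.+1 x y =
  (1 + (x - 1) * y) ^+ N.+1
  + N%:R * (1 - y) * (x - 1) * y * (1 + (x - 1) * y) ^+ N.-1.
Proof.
set z := (x - 1) * y; set D : {set I} := [set~ ord0].
pose S (a : I -> F) := \prod_(i in D) (1 + y * (a i - 1)).
have cardD : #|D| = N by rewrite cardsC1 card_ord.
(* The weight 0 at [m] kills the sets [C] containing [m], which turns the inner sum over
   [m \notin C] into a sum over all [m]. *)
transitivity (S (fun=> x) + \sum_m z * S (fun i => if i == m then 0 else x)).
  rewrite M_triangle_pairs /S -sum_nested_subset_prod.
  under [X in _ = _ + X]eq_bigr => m _.
    rewrite -sum_nested_subset_prod big_distrr /=.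
    under eq_bigr do rewrite big_distrr /=.
    over.
  rewrite /= exchange_big /= -big_split; apply: eq_bigr => B _ /=.
  rewrite exchange_big /= -big_split; apply: eq_bigr => C _ /=.
  rewrite prodr_const mulrDr mulr1; congr (_ + _).
  rewrite big_distrr big_mkcond /=; apply: eq_bigr => m _.
  case: (boolP (m \in C)) => mC /=; first by rewrite (bigD1 m) //= eqxx; ring.
  have -> : \prod_(i in C) (if i == m then 0 else x) = x ^+ #|C|.
    rewrite -prodr_const; apply: eq_bigr => i iC.
    by rewrite ifN //; apply: contraNneq mC => <-.
  by rewrite -/z; ring.
have PE : 1 + y * (x - 1) = 1 + z by rewrite /z mulrC.
have Sx : S (fun=> x) = (1 + z) ^+ N by rewrite /S prodr_const cardD PE.
(* Position 0 lies outside [D], so its term is [z] times [S (fun=> x)] and supplies the missing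
   factor [1 + z]. Any other [m] replaces one factor [1 + z] by [1 - y]. *)
rewrite (bigD1 ord0) //=.
have -> : S (fun i => if i == ord0 then 0 else x) = (1 + z) ^+ N.
  rewrite -Sx; apply: eq_bigr => i; rewrite !inE => /negbTE-> //.
have Sm m : m != ord0 -> S (fun i => if i == m then 0 else x) = (1 - y) * (1 + z) ^+ N.-1.
  move=> m0; rewrite /S (bigD1 m) ?inE //= eqxx; congr (_ * _); first by ring.
  rewrite (eq_bigr (fun=> 1 + z)) => [|i /andP[_ /negbTE->] //].
  have -> : N.-1 = #|D :\ m|.
    by have := congr1 predn (cardsD1 m D); rewrite cardD inE in_set1 m0.
  rewrite -prodr_const.
  by apply: eq_bigl => i; rewrite !inE andbC.
under eq_bigr => m m0 do rewrite Sm //.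
rewrite sumr_const (_ : #|_| = N); last first.
  by rewrite -[RHS]cardD; apply: eq_card => i; rewrite !inE.
rewrite Sx exprS -mulr_natl /z; ring.
Qed.

End MTriangle.

(** * The H-triangle, the antichain sum and their equality *)

Lemma H_triangleE N (F : fieldType) (x y : F) : y - 1 != 0 -> x * (y - 1) + 1 != 0 ->
  H_triangle N.+1 x y = (1 + x * y) ^+ N.+1 + N%:R * x * (1 + x * y) ^+ N.-1.
Proof.
move=> y1 q0; rewrite /H_triangle M_triangleE; set q := x * (y - 1) + 1.
have -> : 1 + (y / (y - 1) - 1) * (x * (y - 1) / q) = (1 + x * y) / q.
  by rewrite /q; field; rewrite q0 y1.
have pow k : q ^+ k * ((1 + x * y) / q) ^+ k = (1 + x * y) ^+ k.
  by rewrite -exprMn mulrC divfK.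
(* For [N = 0], where [N.-1] truncates, the term vanishes. Otherwise the substitution turns
   [(1 - y) * (x - 1) * y] into [x / q ^+ 2], and two factors [q] cancel the denominator. *)
rewrite mulrDr pow; congr (_ + _); case: N => [|k] /=; first by rewrite !mul0r mulr0.
rewrite -[in RHS](pow k) 2!exprS; move: (_ ^+ k) (_ ^+ k) => a b.
by rewrite /q; field; rewrite q0 y1.
Qed.

Lemma sum_antichains (N : nat) (R : comPzRingType) (x y : R) :
  \sum_(A : {set Jposet N.+1} | antichain A) x ^+ #|A| * y ^+ #|A :&: Atom N.+1|
  = (1 + x * y) ^+ N.+1 + N%:R * x * (1 + x * y) ^+ N.-1.
Proof.
pose w j : R := x * (if j \in Atom N.+1 then y else 1).
have wE (A : {set Jposet N.+1}) : x ^+ #|A| * y ^+ #|A :&: Atom N.+1| = \prod_(j in A) w j.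
  rewrite big_split /= prodr_const -big_mkcondr; congr (_ * _).
  by rewrite -prodr_const; apply: eq_bigl => j; rewrite inE.
have sumE (E : {set 'I_N.+1}) : E \subset [set~ ord0] ->
    \sum_(A : {set Jposet N.+1} | A \subset @jb N @: E) \prod_(j in A) w j = (1 + x * y) ^+ #|E|.
  move=> /subsetP E0; rewrite sum_subset_prod big_imset /=; last first.
    by move=> i l /E0 i0 /E0; apply: jb_inj.
  rewrite -prodr_const; apply: eq_bigr => i /E0; rewrite !inE => i0.
  by rewrite /w atom_jb.
have allowed0 (k : 'I_N.+1) : allowed k \subset [set~ ord0].
  by apply/subsetP => i; rewrite !inE => /andP[].
under eq_bigr do rewrite wE.
(* An antichain contains at most one a-element; [None] collects those without any. *)
rewrite (partition_big (fun A : {set Jposet N.+1} => [pick k : 'I_N.+1 | ja k \in A]) predT) //=.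
rewrite (bigD1 None) //=.
rewrite (eq_bigl _ _ (@antichain_no_a N)) sumE // cardsC1 card_ord /=.
rewrite (reindex_omap Some id) => [|[k|] //] /=.
transitivity ((1 + x * y) ^+ N + \sum_k w (ja k) * (1 + x * y) ^+ #|allowed k|).
  congr (_ + _); apply: eq_big => [k|k _]; first by rewrite eqxx.
  rewrite (reindex_onto (fun A : {set Jposet N.+1} => ja k |: A) (fun A => A :\ ja k)); last first.
    by move=> A /andP[_]; case: pickP => // l lA /eqP[<-]; rewrite setD1K.
  rewrite -sumE // big_distrr /=; apply: eq_big => A.
    by rewrite -antichain_one_a andbA.
  case/andP=> _ /eqP kA; rewrite big_setU1 //.
  by rewrite -kA !inE eqxx.
(* Only [ja ord0] is an atom among the a-elements, and it excludes no b-element: its class adds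
   [x * y] times the sum of the class [None]. *)
rewrite (bigD1 ord0) //= card_allowed eqxx /w atom_ja eqxx.
rewrite (eq_bigr (fun=> x * (1 + x * y) ^+ N.-1)) => [|k k0]; last first.
  by rewrite card_allowed atom_ja (negbTE k0) mulr1.
rewrite sumr_const (_ : #|_| = N); last first.
  by rewrite cardC1 card_ord.
by rewrite exprS -mulr_natl; ring.
Qed.

Theorem proposition6p19 (n : nat) (n_gt0 : (0 < n)%N) :
  H_triangle n ratX ratY =
  \sum_(A : {set Jposet n} | antichain A) ratX ^+ #|A| * ratY ^+ #|A :&: Atom n|.
Proof.
case: n n_gt0 => // N _.
have y1 : ratY - 1 != 0.
  by rewrite /ratY -tofrac1 -tofracB tofrac_eq0 polyXsubC_eq0.
have q0 : ratX * (ratY - 1) + 1 != 0.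
  rewrite /ratX /ratY -tofrac1 -tofracB -tofracM -tofracD tofrac_eq0.
  (* Setting the outer indeterminate, which is [ratY], to 1 leaves the constant 1. *)
  apply/eqP => /(congr1 (horner^~ 1)).
  rewrite !hornerE subrr mulr0 add0r => /eqP; exact/negP/oner_neq0.
by rewrite H_triangleE // sum_antichains.
Qed.
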